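(* In each of the asymptotic frameworks (F1), (F2), (F3) the following holds. (a) $A_1$ is an unbiased estimator for $\operatorname{tr}(TV_NT)$, which is in addition dimensionally stable and ratio-consistent if $$\prod_{i=1}^a \frac{(n_i-2)!\,(n_i-2)!}{n_i!\,(n_i-4)!}\to 1 .$$ (b) $A_2$ is an unbiased estimator for $\operatorname{tr}\big((TV_NT)^2\big)$, which is in addition dimensionally stable and ratio-consistent if $$\prod_{i=1}^a \frac{(n_i-4)!\,(n_i-4)!}{n_i!\,(n_i-8)!}\to 1 .$$
   Context: Model: there are $a$ groups; in group $i\in\{1,\dots,a\}$ one observes independent random vectors $X_{i,j}\sim\mathcal N_{d_i}(\mu_i,\Sigma_i)$, $j=1,\dots,n_i$, with $\mu_i\in\mathbb R^{d_i}$ and $\Sigma_i\in\mathbb R^{d_i\times d_i}$ positive definite; all $X_{i,j}$ are independent. The dimensions $d_i$ may differ between groups. Put $N=\sum_{i=1}^a n_i$, $D=\sum_{i=1}^a d_i$, and $V_N=\bigoplus_{i=1}^a \frac{N}{n_i}\Sigma_i$ (block diagonal). $T\in\mathbb R^{D\times D}$ is a nonzero symmetric idempotent matrix. The quantities $a, d_i, n_i,\mu_i,\Sigma_i,T$ may all depend on $N$ (subject to the framework), and limits are along $N\to\infty$. No null hypothesis on the means is assumed. Asymptotic frameworks: (F1) $a$ is fixed and $\min(\max(d_1,\dots,d_a),n_1,\dots,n_a)\to\infty$; (F2) all $d_i$ are fixed and $\min(a,n_1,\dots,n_a)\to\infty$; (F3) $\min(a,\max(d_1,\dots,d_a),n_1,\dots,n_a)\to\infty$.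 Sample sizes are taken large enough that all expressions below are defined. For index vectors $\ell_k=(\ell_{k,1},\dots,\ell_{k,a})$ with $\ell_{k,i}\in\{1,\dots,n_i\}$ put $$Z_{(\ell_1,\ell_2)}=\Big(\sqrt{\tfrac{N}{n_1}}(X_{1,\ell_{1,1}}-X_{1,\ell_{2,1}})^\top,\dots,\sqrt{\tfrac{N}{n_a}}(X_{a,\ell_{1,a}}-X_{a,\ell_{2,a}})^\top\Big)^\top\in\mathbb R^D .$$ Estimators: $$A_1=\sum \frac{Z_{(\ell_1,\ell_2)}^\top T Z_{(\ell_1,\ell_2)}}{2\prod_{i=1}^a\binom{n_i}{2}},$$ the sum being over all index vectors with $1\le \ell_{1,i}<\ell_{2,i}\le n_i$ for each $i=1,\dots,a$, and $$A_2=\sum \frac{\big[Z_{(\ell_1,\ell_2)}^\top T Z_{(\ell_3,\ell_4)}\big]^2}{4\prod_{i=1}^a 6\binom{n_i}{4}},$$ the sum being over all index vectors such that for each $i$ the indices $\ell_{1,i},\ell_{2,i},\ell_{3,i},\ell_{4,i}\in\{1,\dots,n_i\}$ are pairwise distinct with $\ell_{1,i}<\ell_{2,i}$ and $\ell_{3,i}<\ell_{4,i}$. An estimator $\hat\theta_N$ of $\theta_N>0$ is ratio-consistent if $\hat\theta_N/\theta_N\to1$ in probability. It is dimensionally stable if $|\mathbb E(\hat\theta_N/\theta_N)-1|$ and $\operatorname{Var}(\hat\theta_N/\theta_N)$ are bounded by a null sequence depending only on $a$ and the sample sizes $n_1,\dots,n_a$ (not on the dimensions $d_i$, on $\Sigma_i$,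 or on $T$). *)

(* Defs.v *)
From HB Require Import structures.
From mathcomp Require Import all_boot all_order all_algebra.
From mathcomp Require Import all_classical all_reals all_analysis.

Set Implicit Arguments.
Unset Strict Implicit.
Unset Printing Implicit Defensive.

Import Order.TTheory GRing.Theory Num.Theory.
Import numFieldNormedType.Exports.

Local Open Scope classical_set_scope.
Local Open Scope ring_scope.

Definition borel_cV (R : realType) (d : nat) : set (set 'cV[R]_d) :=
  g_sigma_preimage (fun (k : 'I_d) (x : 'cV[R]_d) => x k 0).

Definition random_vector disp (Omega : measurableType disp) (R : realType)
    (d : nat) (X : Omega -> 'cV[R]_d) : Prop :=
  forall k : 'I_d, measurable_fun setT (fun w => X w k 0).

Definition posdefmx (R : realType) (d : nat) (S : 'M[R]_d) : Prop :=
  S^T = S /\ forall u : 'cV[R]_d, u != 0 -> 0 < (u^T *m S *m u) 0 0.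

(* [X ~ N_d(mu, S)] for positive definite [S], through the laws of the linear
   forms [u^T X].  The second parameter of [normal_prob] is the standard
   deviation, and [normal_prob m 0] is not a Dirac mass, so [u = 0] has to be
   left out; [u^T S u > 0] for all other [u]. *)
Definition multivariate_normal disp (Omega : measurableType disp)
    (R : realType) (P : probability Omega R) (d : nat)
    (mu : 'cV[R]_d) (S : 'M[R]_d) (X : Omega -> 'cV[R]_d) : Prop :=
  forall u : 'cV[R]_d, u != 0 ->
  forall B : set R, measurable B ->
    P ((fun w => (u^T *m X w) 0 0) @^-1` B) =
    normal_prob ((u^T *m mu) 0 0) (Num.sqrt ((u^T *m S *m u) 0 0)) B.

(* The product rule for subfamilies is the case [B p = setT] for the others. *)
Definition mutually_independent disp (Omega : measurableType disp)
    (R : realType) (P : probability Omega R) (I : finType) (d : I -> nat)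
    (X : forall p : I, Omega -> 'cV[R]_(d p)) : Prop :=
  forall B : forall p : I, set 'cV[R]_(d p),
    (forall p, borel_cV (B p)) ->
    P (\bigcap_(p in [set: I]) (X p @^-1` B p)) =
    (\prod_(p : I) P (X p @^-1` B p))%E.

(* One experiment with [a] groups and sample sizes [n]: everything else,
   including the dimensions, is part of the record. *)
Record model (R : realType) (a : nat) (n : 'I_a -> nat) := Model {
  gdim : 'I_a -> nat;
  mean : forall i, 'cV[R]_(gdim i);
  Sigma : forall i, 'M[R]_(gdim i);
  proj : 'M[R]_(\sum_(i < a) gdim i);
  disp : measure_display;
  Omega : measurableType disp;
  prob : probability Omega R;
  obs : forall i, 'I_(n i) -> Omega -> 'cV[R]_(gdim i);
  gdim_gt0 : forall i, (0 < gdim i)%N;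
  Sigma_posdef : forall i, posdefmx (Sigma i);
  proj_sym : proj^T = proj;
  proj_idem : proj *m proj = proj;
  proj_neq0 : proj != 0;
  obs_random : forall i j, random_vector (@obs i j);
  obs_normal : forall i j,
    multivariate_normal prob (mean i) (Sigma i) (@obs i j);
  obs_indep : mutually_independent prob
    (fun p : {i : 'I_a & 'I_(n i)} => @obs (tag p) (tagged p))
}.

Arguments obs {R a n} m i _ _.

Section Estimators.
Variables (R : realType) (a : nat) (n : 'I_a -> nat) (M : model R n).

Let N : nat := (\sum_(i < a) n i)%N.

Definition VN : 'M[R]_(\sum_(i < a) gdim M i) :=
  \mxdiag_(i < a) ((N%:R / (n i)%:R) *: Sigma M i).

Definition index_vector := {dffun forall i : 'I_a, 'I_(n i)}.

Definition Z (l1 l2 : index_vector) (w : Omega M) :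
    'cV[R]_(\sum_(i < a) gdim M i) :=
  \mxcol_(i < a) (Num.sqrt (N%:R / (n i)%:R) *:
                  (obs M i (l1 i) w - obs M i (l2 i) w)).

Definition A1 (w : Omega M) : R :=
  \sum_(l1 : index_vector)
  \sum_(l2 : index_vector | [forall i, (l1 i < l2 i)%N])
    ((Z l1 l2 w)^T *m proj M *m Z l1 l2 w) 0 0
      / (2 * \prod_(i < a) 'C(n i, 2))%N%:R.

Definition A2 (w : Omega M) : R :=
  \sum_(l1 : index_vector) \sum_(l2 : index_vector)
  \sum_(l3 : index_vector)
  \sum_(l4 : index_vector |
      [forall i, [&& uniq [:: l1 i; l2 i; l3 i; l4 i],
                     (l1 i < l2 i)%N & (l3 i < l4 i)%N]])
    (((Z l1 l2 w)^T *m proj M *m Z l3 l4 w) 0 0) ^+ 2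
      / (4 * \prod_(i < a) (6 * 'C(n i, 4)))%N%:R.

Definition trTVT : R := \tr (proj M *m VN *m proj M).

Definition trTVT2 : R :=
  \tr ((proj M *m VN *m proj M) *m (proj M *m VN *m proj M)).

End Estimators.

Inductive framework := F1 | F2 | F3.

Definition in_framework (F : framework) (a : nat -> nat)
    (n d : forall nu, 'I_(a nu) -> nat) : Prop :=
  match F with
  | F1 => (exists a0, forall nu, a nu = a0) /\
      (fun nu => \big[minn/(\max_(i < a nu) d nu i)%N]_(i < a nu) n nu i)
        @ \oo --> \oo
  | F2 => (exists d0 : nat -> nat, forall nu i, d nu i = d0 i) /\
      (fun nu => \big[minn/a nu]_(i < a nu) n nu i) @ \oo --> \oo
  | F3 =>
      (fun nu => \big[minn/minn (a nu) (\max_(i < a nu) d nu i)%N]_(i < a nu)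
                   n nu i) @ \oo --> \oo
  end.

Definition estimator (R : realType) :=
  forall (a : nat) (n : 'I_a -> nat) (M : model R n), Omega M -> R.

Definition estimand (R : realType) :=
  forall (a : nat) (n : 'I_a -> nat), model R n -> R.

Definition unbiased (R : realType) (est : estimator R) (theta : estimand R)
    (a : nat) (n : 'I_a -> nat) (M : model R n) : Prop :=
  ('E_(prob M)[est a n M] = (theta a n M)%:E)%E.

Definition ratio_to (R : realType) (est : estimator R) (theta : estimand R)
    (a : nat) (n : 'I_a -> nat) (M : model R n) : Omega M -> R :=
  fun w => est a n M w / theta a n M.

Definition ratio_consistent (R : realType) (est : estimator R)
    (theta : estimand R) (a : nat -> nat) (n : forall nu, 'I_(a nu) -> nat)
    (M : forall nu, model R (n nu)) : Prop :=
  forall eps : R, 0 < eps ->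
    (fun nu => prob (M nu) [set w | eps < `|ratio_to est theta w - 1|])
      @ \oo --> 0%E.

(* [g] sees only the number of groups and the sample sizes, and the bounds hold
   for every model with these, whatever its dimensions, means, covariances and
   projection.  [m] is the sample size from which [est] is defined. *)
Definition dimensionally_stable (R : realType) (m : nat) (est : estimator R)
    (theta : estimand R) (a : nat -> nat)
    (n : forall nu, 'I_(a nu) -> nat) : Prop :=
  exists g : forall a0 : nat, ('I_a0 -> nat) -> R,
    (fun nu => g (a nu) (n nu)) @ \oo --> (0 : R) /\
    forall nu, (forall i, (m <= n nu i)%N) ->
    forall M : model R (n nu),
      (`| 'E_(prob M)[ratio_to est theta (M := M)] - 1 | <= (g (a nu) (n nu))%:E)%E
      /\ ('V_(prob M)[ratio_to est theta (M := M)] <= (g (a nu) (n nu))%:E)%E.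

(* [(n_i - k)! (n_i - k)! / (n_i! (n_i - 2k)!) = 'C(n_i - k, k) / 'C(n_i, k)];
   truncated subtraction matters only for [n i < 2 * k]. *)
Definition fact_ratio (R : realType) (k a : nat) (n : 'I_a -> nat) : R :=
  \prod_(i < a)
    (((n i - k)`! * (n i - k)`!)%N%:R / ((n i)`! * (n i - 2 * k)`!)%N%:R).

(* Main.v *)
From HB Require Import structures.
From mathcomp Require Import all_boot all_order all_algebra.
From mathcomp Require Import all_classical all_reals all_analysis.
From mathcomp Require Import measurable_realfun.
From mathcomp Require Import ring lra.
Require Import Defs.

(** Both estimators average one summand over tuples of index vectors, and two
    summands are independent, hence uncorrelated, as soon as their tuples share
    no observation in any group.  The proportion of such disjoint pairs of
    tuples is exactly the product of the quotients 'C(n_i - k, k) / 'C(n_i, k)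
    with k = 2 or 4, which for n_i >= 2 k is the product of factorials that is
    assumed to tend to 1.  If the second moment of every summand is at most K
    times the square of the estimand, the variance of the average, relative to
    that square, is therefore at most K (1 - proportion) ([expect_ustat_var],
    [count_pairs], [count_quads], [prod_bin_ratio]).  Chebyshev's inequality
    then gives ratio consistency.

    The point is that K does not depend on the dimension ([A1_summand],
    [A2_summand]).  A difference of two observations of one group is centred,
    and a Gaussian vector x with covariance S satisfies
      E (u^T x)^2 = u^T S u   and   E (u^T x)^4 <= 64 (u^T S u)^2
    for all u ([kurt_vec]).  This property passes to independent sums and to
    linear images, so it reaches the vectors T Z from the single observations
    ([kurt_var_normal], [kurt_vec_proj_Z]), and with it the second moments,
    which give unbiasedness.  Since T is a symmetric idempotent, the summands
    are |T Z|^2 / 2 and ((T Z)^T (T Z'))^2 / 4 with Z and Z' independent.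
    - For the first one the Cauchy-Schwarz inequality, coordinate by coordinate,
      gives E |y|^4 <= 64 (tr S)^2 ([kurt_vec_trace_sqr]).
    - For the second one, x^T y is for a fixed y a linear form in x, so
      E (x^T y)^4 <= 64 E (y^T S y)^2; and S = E x x^T makes y^T S y an average
      of squares of linear forms in y, to which the bound for y applies
      ([kurt_vec_dual], [expect_dot_quartic_le]).  No diagonalization of S is
      involved.

    All random variables that occur are polynomials in the centred observations.
    They lie in the span of the products of functions of one observation each
    ([tame_span]), on which mutual independence gives E (F G) = E F E G whenever
    F and G depend on disjoint sets of observations ([expect_indep]). *)

Set Implicit Arguments.
Unset Strict Implicit.
Unset Printing Implicit Defensive.

Import Order.TTheory GRing.Theory Num.Theory.
Import numFieldNormedType.Exports.

Local Open Scope classical_set_scope.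
Local Open Scope ring_scope.

(** * Integration against a measure with a density *)

Section density.
Local Open Scope ereal_scope.
Context d d' (T : measurableType d) (T' : measurableType d') (R : realType).
Variables (mu : {measure set T -> \bar R}) (nu : {measure set T' -> \bar R}).
Variables (phi : T -> T') (W : T -> R).
Hypothesis mphi : measurable_fun setT phi.
Hypothesis mW : measurable_fun setT W.
Hypothesis W0 : forall x, (0 <= W x)%R.
Hypothesis nuE : forall B, measurable B ->
  nu B = \int[mu]_x (W x * \1_B (phi x))%:E.

Import HBNNSimple.

(** The hypothesis says that [nu] is the image under [phi] of the measure with
    density [W].  The formula then holds for simple functions, and passes to
    increasing limits.  It is used with a normal density for [W], and with the
    product of all factors but one in an independent product. *)
Lemma ge0_integral_density (f : T' -> R) :
  measurable_fun setT f -> (forall y, (0 <= f y)%R) ->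
  \int[nu]_y (f y)%:E = \int[mu]_x (W x * f (phi x))%:E.
Proof.
move=> mf f0.
have mEf : measurable_fun setT (fun y : T' => (f y)%:E) by exact/measurable_EFinP.
pose h := nnsfun_approx measurableT mEf.
have hcvg y : (EFin \o h n) y @[n --> \oo] --> (f y)%:E.
  by apply: (cvg_nnsfun_approx measurableT mEf) => // t _; rewrite lee_fin.
have -> : \int[nu]_y (f y)%:E =
    lim (\int[nu]_y (EFin \o h n) y @[n --> \oo]).
  have fE y : (f y)%:E = lim ((EFin \o h n) y @[n --> \oo]).
    exact/esym/cvg_lim.
  under eq_integral => y _ do rewrite fE.
  apply: monotone_convergence => //.
  - by move=> n; exact/measurable_EFinP.
  - by move=> n x _; rewrite lee_fin.
  - by move=> x _ a b ab; rewrite lee_fin; exact/lefP/nd_nnsfun_approx.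
have mhphi n : measurable_fun setT (h n \o phi) by exact: measurableT_comp.
have -> : \int[mu]_x (W x * f (phi x))%:E =
    lim (\int[mu]_x (W x * h n (phi x))%:E @[n --> \oo]).
  have fg x : (W x * f (phi x))%:E = lim ((W x * h n (phi x))%:E @[n --> \oo]).
    apply/esym/cvg_lim => //.
    under eq_fun do rewrite EFinM.
    by rewrite EFinM; apply: cvgeZl => //; exact: hcvg.
  under eq_integral => x _ do rewrite fg.
  apply: monotone_convergence => [//| | |].
  - by move=> n; apply/measurable_EFinP; apply: measurable_funM => //; exact: mhphi.
  - by move=> n x _; rewrite lee_fin mulr_ge0.
  - move=> x _ a b ab; rewrite lee_fin ler_wpM2l//.
    exact/lefP/nd_nnsfun_approx.
suff suf n : \int[nu]_y (EFin \o h n) y = \int[mu]_x (W x * h n (phi x))%:E.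
  by under eq_fun do rewrite suf.
have mpre r : measurable (h n @^-1` [set r]) by [].
transitivity (\sum_(y \in range (h n))
    \int[nu]_x (y * \1_(h n @^-1` [set y]) x)%:E).
  rewrite -ge0_integral_fsum//.
  - by apply: eq_integral => t _; rewrite /= fimfunE -fsumEFin.
  - by move=> r; apply/measurable_EFinP; exact: measurable_funM.
  - by move=> m y _; exact: nnfun_muleindic_ge0.
have m1 r : measurable_fun setT (\1_(h n @^-1` [set r]) \o phi : T -> R).
  by apply: measurableT_comp => //.
transitivity (\sum_(y \in range (h n))
    \int[mu]_x ((y * \1_(h n @^-1` [set y]) (phi x))%:E * (W x)%:E)); last first.
  rewrite -ge0_integral_fsum//.
  - apply: eq_integral => x _.
    rewrite mulrC EFinM fimfunE -fsumEFin//.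
    rewrite ge0_mule_fsuml => [//|y]; exact: nnfun_muleindic_ge0.
  - move=> r; apply: emeasurable_funM; apply/measurable_EFinP => //.
    by apply: measurable_funM => //; exact: m1.
  - by move=> m y _; apply: mule_ge0; [exact: nnfun_muleindic_ge0|rewrite lee_fin].
apply: eq_fsbigr => r rhn.
have r0 : (0 <= r)%R by move: rhn; rewrite inE => -[t _ <-].
under eq_integral do rewrite EFinM.
rewrite integralZl_indic_nnsfun// integral_indic// setIT nuE//.
under [RHS]eq_integral do rewrite EFinM -muleA.
rewrite ge0_integralZl//.
- by congr *%E; apply: eq_integral => x _; rewrite EFinM muleC.
- by apply: emeasurable_funM; apply/measurable_EFinP => //; exact: m1.
- by move=> x _; rewrite mule_ge0 ?lee_fin.
Qed.

End density.

(** * Moments of a normal variable *)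

Section normal_moments.
Context (R : realType).
Notation mu := (@lebesgue_measure R).
Implicit Types m s b x : R.

(** Half of the Gaussian exponent absorbs the power, by z^k <= k! e^z with
    z = (x - m)^2 / (4 s^2), and what remains is a normal density of twice the
    variance.  So all even moments come with the right scaling in [s]. *)
Lemma normal_pdf_even_moment_le m s k x : 0 < s ->
  normal_pdf m s x * (x - m) ^+ (2 * k) <=
  normal_pdf m (Num.sqrt 2 * s) x * (2 * k`!%:R * 4 ^+ k * s ^+ (2 * k)).
Proof.
move=> s0; have s20 : 0 < s ^+ 2 by rewrite exprn_gt0.
have sn0 : s != 0 by rewrite gt_eqF.
have t0 : 0 < Num.sqrt 2 * s :> R by rewrite mulr_gt0 ?sqrtr_gt0.
have t2 : (Num.sqrt 2 * s) ^+ 2 = 2 * s ^+ 2 :> R by rewrite exprMn sqr_sqrtr.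
rewrite !normal_pdfE ?gt_eqF//.
have peakE : normal_peak s = Num.sqrt 2 * normal_peak (Num.sqrt 2 * s).
  rewrite /normal_peak t2 -!mulrnAr -(mulrA 2) [in RHS]sqrtrM// invfM.
  by rewrite mulrA divff ?mul1r// gt_eqF// sqrtr_gt0.
set z := (x - m) ^+ 2 / (4 * s ^+ 2).
have z0 : 0 <= z by rewrite /z divr_ge0 ?sqr_ge0// mulr_ge0 ?sqr_ge0.
have f1 : normal_fun m s x = expR (- z) * expR (- z).
  rewrite -expRD /normal_fun; congr expR; rewrite /z; by field.
have f2 : normal_fun m (Num.sqrt 2 * s) x = expR (- z).
  rewrite /normal_fun t2; congr expR; rewrite /z; by field.
have xm : (x - m) ^+ (2 * k) = z ^+ k * (4 ^+ k * s ^+ (2 * k)).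
  rewrite !exprM -!exprMn; congr (_ ^+ _); rewrite /z; by field.
have zk : z ^+ k <= k`!%:R * expR z.
  have kf : 0 < k`!%:R :> R by rewrite ltr0n fact_gt0.
  case: k xm kf => [|k] _ kf.
    by rewrite expr0 fact0 mul1r -expR0 ler_expR.
  rewrite mulrC -ler_pdivrMr//; apply: le_trans (expR_ge1Dxn k z0).
  by rewrite lerDr.
rewrite f1 f2 xm peakE.
have s2 : Num.sqrt 2 <= 2 :> R.
  by rewrite -[leRHS]ger0_norm// -sqrtr_sqr ler_wsqrtr// expr2 ler_peMr// ler1n.
have h1 : expR (- z) * z ^+ k <= k`!%:R.
  by rewrite expRN mulrC ler_pdivrMr ?expR_gt0.
set p := normal_peak _; have p0 : 0 <= p by exact: normal_peak_ge0.
set e := expR (- z) in h1 *; have e0 : 0 <= e by exact: expR_ge0.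
set q := 4 ^+ k * s ^+ (2 * k).
have q0 : 0 <= q by rewrite mulr_ge0 ?exprn_ge0 ?ltW.
have -> : Num.sqrt 2 * p * (e * e) * (z ^+ k * q) =
  (p * e * q) * (Num.sqrt 2 * (e * z ^+ k)) by ring.
have -> : p * e * (2 * k`!%:R * 4 ^+ k * s ^+ (2 * k)) =
  (p * e * q) * (2 * k`!%:R) by rewrite /q; ring.
apply: ler_wpM2l; first by do 2 apply: mulr_ge0 => //.
by apply: ler_pM => //; rewrite ?sqrtr_ge0// mulr_ge0 ?exprn_ge0.
Qed.

Let Q m s : R -> R := cst (- (s ^+ 2 *+ 2)^-1) * (id - cst m) ^+ 2.

(** An antiderivative of ((x - m + b)^2 - (s^2 + b^2)) times the density. *)
Let F m s b : R -> R :=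
  (cst (- (s ^+ 2 * normal_peak s)) * (id - cst m + cst (b *+ 2)))
  * (expR \o Q m s).

Let FE m s b x : s != 0 ->
  F m s b x = - (s ^+ 2 * (x - m + b *+ 2) * normal_pdf m s x).
Proof.
move=> s0; rewrite /F normal_pdfE// /Q !fctE/=.
have -> : normal_fun m s x = expR (- (s ^+ 2 *+ 2)^-1 * (x - m) ^+ 2).
  by congr expR; rewrite mulrC mulrN mulNr.
by ring.
Qed.

Let derF m s b x : s != 0 -> is_derive x (1 : R) (F m s b)
  (normal_pdf m s x * (x - m + b) ^+ 2 - normal_pdf m s x * (s ^+ 2 + b ^+ 2)).
Proof.
move=> s0.
have dQ : is_derive x (1 : R) (Q m s) (- (x - m) / s ^+ 2).
  apply: is_derive_eq; rewrite !fctE /= /GRing.scale/=; field.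
  by rewrite s0.
have dE : is_derive x (1 : R) (expR \o Q m s)
    (- (x - m) / s ^+ 2 * expR (Q m s x)).
  have := is_derive1_comp (is_derive_expR (Q m s x)) dQ.
  by rewrite mulrC.
apply: is_derive_eq.
have -> : normal_pdf m s x = normal_peak s * expR (Q m s x).
  rewrite normal_pdfE// /Q !fctE/=; congr (_ * expR _).
  by rewrite mulrC mulrN mulNr.
rewrite !fctE /= /GRing.scale/=; field.
by rewrite s0.
Qed.

Let cont_pdf_sqr m s b : s != 0 ->
  continuous (fun x => normal_pdf m s x * (x - m + b) ^+ 2).
Proof.
move=> s0 x; apply: cvgM; first exact: continuous_normal_pdf.
apply: (cvg_comp (fun x => x - m + b) (fun x => x ^+ 2)).
  by apply: cvgD; [apply: cvgB; [exact: cvg_id|exact: cvg_cst]|exact: cvg_cst].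
exact: sqr_continuous.
Qed.

Let cont_pdf_cst m s c : s != 0 -> continuous (fun x => normal_pdf m s x * c).
Proof.
by move=> s0 x; apply: cvgM; [exact: continuous_normal_pdf|exact: cvg_cst].
Qed.

Let gap m s b n := F m s b (m + n.+1%:R) - F m s b (m - n.+1%:R).

Let cvg_gap m s b : s != 0 -> gap m s b n @[n --> \oo] --> (0 : R).
Proof.
move=> s0; have s20 : 0 < s ^+ 2 by rewrite exprn_even_gt0.
have ps0 : 0 <= normal_peak s by exact: normal_peak_ge0.
pose C := 4 * s ^+ 4 * normal_peak s.
have FEy y : F m s b (m + y) - F m s b (m - y) =
    - (2 * s ^+ 2 * normal_peak s * y * expR (- (y ^+ 2 / (s ^+ 2 *+ 2)))).
  rewrite !FE// !normal_pdfE// /normal_fun.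
  have -> : m - y - m = - y by ring.
  have -> : m + y - m = y by ring.
  by rewrite sqrrN mulNr; ring.
have gapE n : gap m s b n = - (2 * s ^+ 2 * normal_peak s * n.+1%:R *
    expR (- (n.+1%:R ^+ 2 / (s ^+ 2 *+ 2)))) by exact: FEy.
have gap_le n : `|gap m s b n| <= C * harmonic n.
  rewrite gapE normrN ger0_norm; last first.
    by do ![exact: (ltW s20)|exact: expR_ge0|apply: mulr_ge0 => //].
  rewrite expRN.
  have n0 : 0 < n.+1%:R :> R by [].
  have e0 : 0 < n.+1%:R ^+ 2 / (s ^+ 2 *+ 2) :> R.
    by rewrite divr_gt0 ?exprn_gt0// pmulrn_rgt0.
  apply: (@le_trans _ _ (2 * s ^+ 2 * normal_peak s * n.+1%:R *
      (n.+1%:R ^+ 2 / (s ^+ 2 *+ 2))^-1)).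
    apply: ler_wpM2l; first by do ![exact: (ltW s20)|apply: mulr_ge0 => //].
    rewrite lef_pV2 ?posrE ?expR_gt0//.
    by apply: le_trans (expR_ge1Dx _); rewrite lerDr.
  rewrite le_eqVlt; apply/orP; left; apply/eqP.
  rewrite /harmonic/= /C; field.
  by rewrite s0 andbT nat1r pnatr_eq0.
apply/norm_cvg0P.
apply: (@squeeze_cvgr _ _ _ _ (cst 0) (fun n => C * harmonic n)).
- by near=> n; rewrite normr_ge0 gap_le.
- exact: cvg_cst.
- by rewrite -[X in _ --> X](mulr0 C); apply: cvgMl_tmp; exact: cvg_harmonic.
Unshelve. all: by end_near. Qed.

(** The antiderivative [F] has vanishing increments over the growing intervals
    centred at [m].  The shift [b] keeps the integrand nonnegative: [b = 0] gives
    the variance, and comparing with [b = 1] gives the mean. *)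
Lemma integral_normal_pdf_sqr m s b : 0 < s ->
  (\int[mu]_x (normal_pdf m s x * (x - m + b) ^+ 2)%:E = (s ^+ 2 + b ^+ 2)%:E)%E.
Proof.
move=> sgt0; have s0 : s != 0 by rewrite gt_eqF.
pose g1 x := normal_pdf m s x * (x - m + b) ^+ 2.
pose g2 x := normal_pdf m s x * (s ^+ 2 + b ^+ 2).
have c0 : 0 <= s ^+ 2 + b ^+ 2 by rewrite addr_ge0 ?sqr_ge0.
have g10 x : 0 <= g1 x by rewrite mulr_ge0 ?normal_pdf_ge0 ?sqr_ge0.
have g20 x : 0 <= g2 x by rewrite mulr_ge0 ?normal_pdf_ge0.
have cg1 : continuous g1 by exact: cont_pdf_sqr.
have cg2 : continuous g2 by exact: cont_pdf_cst.
have g2E : (\int[mu]_x (g2 x)%:E = (s ^+ 2 + b ^+ 2)%:E)%E.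
  under eq_integral do rewrite EFinM.
  rewrite ge0_integralZr//.
  - by rewrite integral_normal_pdf mul1e.
  - by apply/measurable_EFinP; exact: measurable_normal_pdf.
  - by move=> x _; rewrite lee_fin normal_pdf_ge0.
pose D n := `[m - n.+1%:R, m + n.+1%:R]%classic : set R.
have Dint (g : R -> R) n : continuous g -> mu.-integrable (D n) (EFin \o g).
  move=> cg; apply: continuous_compact_integrable.
    exact: segment_compact.
  exact: continuous_subspaceT.
have DT : \bigcup_n D n = setT.
  apply/seteqP; split => // x _.
  exists (Num.truncn `|x - m|) => //; rewrite /D/= in_itv/=.
  have : `|x - m| < (Num.truncn `|x - m|).+1%:R by rewrite truncnS_gt.
  by rewrite ltr_norml => /andP[h1 h2]; apply/andP; split; lra.
have mD n : (R.-ocitv.-measurable).-sigma.-measurable (D n) by exact: measurable_itv.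
have ndD : nondecreasing_seq D.
  move=> i j ij; rewrite subsetEset => x; rewrite /D/= !in_itv/=.
  have : i.+1%:R <= j.+1%:R :> R by rewrite ler_nat.
  by move=> h /andP[h1 h2]; apply/andP; split; lra.
have DE n : (\int[mu]_(x in D n) (g1 x)%:E =
    \int[mu]_(x in D n) (g2 x)%:E + (gap m s b n)%:E)%E.
  have lt : m - n.+1%:R < m + n.+1%:R.
    by have : 0 < n.+1%:R :> R by []; lra.
  have dF x := derF m b x s0.
  have cF x : {for x, continuous (F m s b)}.
    apply: differentiable_continuous; apply/derivable1_diffP.
    exact: ex_derive.
  have : (\int[mu]_(x in D n) (g1 x - g2 x)%:E = (gap m s b n)%:E)%E.
    rewrite (@continuous_FTC2 _ (fun x => g1 x - g2 x) (F m s b) _ _ lt) //.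
    - apply: continuous_subspaceT => x.
      by apply: cvgB; [exact: cg1|exact: cg2].
    - split.
      + by move=> x _; exact: ex_derive.
      + by apply: cvg_at_right_filter; exact: cF.
      + by apply: cvg_at_left_filter; exact: cF.
    - by move=> x _; rewrite derive1E derive_val.
  under eq_integral do rewrite EFinB.
  rewrite (integralB_EFin (mD n) (Dint g1 n cg1) (Dint g2 n cg2)) => <-.
  rewrite addeC subeK//; by apply: integrable_fin_num; [exact: mD|exact: Dint].
have mg1 : measurable_fun setT (EFin \o g1).
  by apply/measurable_EFinP; exact: continuous_measurable_fun.
have mg2 : measurable_fun setT (EFin \o g2).
  by apply/measurable_EFinP; exact: continuous_measurable_fun.
have lim1 : (\int[mu]_(x in D n) (g1 x)%:E @[n --> \oo] -->
             \int[mu]_x (g1 x)%:E)%E.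
  rewrite -DT; apply: ge0_nondecreasing_set_cvg_integral => //.
  - by move=> n; exact: measurable_funTS.
  - by move=> n x _; rewrite lee_fin.
have lim2 : (\int[mu]_(x in D n) (g2 x)%:E @[n --> \oo] -->
             \int[mu]_x (g2 x)%:E)%E.
  rewrite -DT; apply: ge0_nondecreasing_set_cvg_integral => //.
  - by move=> n; exact: measurable_funTS.
  - by move=> n x _; rewrite lee_fin.
have lim3 : (\int[mu]_(x in D n) (g1 x)%:E @[n --> \oo] -->
             (s ^+ 2 + b ^+ 2)%:E)%E.
  have lim0 : ((gap m s b n)%:E @[n --> \oo] --> 0)%E.
    by apply/fine_cvgP; split; [exact: nearW|exact: cvg_gap].
  have := cvgeD _ lim2 lim0; rewrite adde0 g2E.
  rewrite fin_num_adde_defl// => /(_ eventually_filter).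
  under [X in _ -> X @ _ --> _]eq_fun do rewrite DE.
  exact.
by move/cvg_lim : lim1 => <- //; exact/cvg_lim.
Qed.

End normal_moments.

Section gaussian_moments.
Context d (Omega : measurableType d) (R : realType) (P : probability Omega R).
Variables (Y : Omega -> R) (m s : R).
Hypothesis mY : measurable_fun setT Y.
Hypothesis s0 : 0 < s.
Hypothesis lawY : forall B : set R, measurable B -> P (Y @^-1` B) = normal_prob m s B.
Notation mu := (@lebesgue_measure R).

Lemma ge0_integral_gaussian (h : R -> R) :
  measurable_fun setT h -> (forall x, 0 <= h x) ->
  (\int[P]_w (h (Y w))%:E = \int[mu]_x (normal_pdf m s x * h x)%:E)%E.
Proof.
move=> mh h0.
have := @ge0_integral_pushforward _ _ _ _ _ _ mY P setT (EFin \o h).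
rewrite preimage_setT => <- //.
- apply: (@ge0_integral_density _ _ _ _ _ mu (pushforward P Y) id) => //.
  + exact: measurable_normal_pdf.
  + exact: normal_pdf_ge0.
  + move=> B mB; rewrite [LHS]lawY// /normal_prob [LHS]integral_mkcond.
    apply: eq_integral => x _; rewrite patchE indicE.
    by case: ifPn => xB; rewrite ?mulr1 ?mulr0.
- exact/measurable_EFinP.
- by move=> x _; rewrite lee_fin.
Qed.

Lemma gaussian_even_moment_le k :
  (\int[P]_w ((Y w - m) ^+ (2 * k))%:E <=
   (2 * k`!%:R * 4 ^+ k * s ^+ (2 * k))%:E)%E.
Proof.
have c0 : 0 <= 2 * k`!%:R * 4 ^+ k * s ^+ (2 * k).
  by do ![exact: (ltW s0)|apply: exprn_ge0|apply: mulr_ge0 => //].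
have mh : measurable_fun [set: R] (fun x => (x - m) ^+ (2 * k)).
  by apply: measurable_funX; exact: measurable_funB.
have h0 x : 0 <= (x - m) ^+ (2 * k) by rewrite exprM exprn_ge0// sqr_ge0.
rewrite (ge0_integral_gaussian (h := fun x => (x - m) ^+ (2 * k)))//.
apply: (@le_trans _ _ (\int[mu]_x (normal_pdf m (Num.sqrt 2 * s) x *
    (2 * k`!%:R * 4 ^+ k * s ^+ (2 * k)))%:E)%E).
  apply: ge0_le_integral => //.
  - by move=> x _; rewrite lee_fin mulr_ge0 ?normal_pdf_ge0.
  - apply/measurable_EFinP; apply: measurable_funM => //.
    exact: measurable_normal_pdf.
  - apply/measurable_EFinP; apply: measurable_funM => //.
    exact: measurable_normal_pdf.
  - by move=> x _; rewrite lee_fin normal_pdf_even_moment_le.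
under eq_integral do rewrite EFinM.
rewrite ge0_integralZr//.
- by rewrite integral_normal_pdf mul1e.
- by apply/measurable_EFinP; exact: measurable_normal_pdf.
- by move=> x _; rewrite lee_fin normal_pdf_ge0.
Qed.

Lemma gaussian_shifted_sqr b :
  (\int[P]_w ((Y w - m + b) ^+ 2)%:E = (s ^+ 2 + b ^+ 2)%:E)%E.
Proof.
rewrite -(integral_normal_pdf_sqr m b s0).
rewrite (ge0_integral_gaussian (h := fun x => (x - m + b) ^+ 2))//.
- apply: measurable_funX; apply: measurable_funD => //.
  exact: measurable_funB.
- by move=> x; exact: sqr_ge0.
Qed.

End gaussian_moments.

(** * Products of functions of independent vectors *)

Section borel_columns.
Context (R : realType).

Definition coord_system n : set (set 'cV[R]_n) :=
  \big[setU/set0]_(i < n)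
    preimage_set_system setT (fun x : 'cV[R]_n => x i 0) measurable.

Lemma coord_systemP n (A : set 'cV[R]_n) : coord_system A ->
  exists k B, measurable B /\ A = (fun x : 'cV[R]_n => x k 0) @^-1` B.
Proof.
rewrite /coord_system; elim/big_rec : _ => // i x _ IH [|//].
by move=> [B mB <-]; exists i, B; rewrite setTI.
Qed.

(** The sigma-algebra of [borel_cV], as the structure of a measurable type. *)
Definition cV_measurableType n : measurableType _ :=
  g_sigma_algebraType (@coord_system n).

Lemma measurable_coord n (k : 'I_n) :
  measurable_fun setT (fun x : cV_measurableType n => (x : 'cV[R]_n) k 0).
Proof.
move=> _ B mB; apply: sub_sigma_algebra.
suff : @coord_system n (setT `&` (fun x : 'cV[R]_n => x k 0) @^-1` B) by [].
by rewrite /coord_system (bigD1 k)//=; left; exists B.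
Qed.

Lemma measurable_random_vector d (Omega : measurableType d) n
    (X : Omega -> 'cV[R]_n) :
  random_vector X -> measurable_fun setT (X : Omega -> cV_measurableType n).
Proof.
move=> mX; apply: (@measurability _ _ _ (cV_measurableType n) _ _
   (@coord_system n)) => //.
move=> _ [A /coord_systemP[k [B [mB ->]]] <-].
by have := mX k measurableT B mB.
Qed.

End borel_columns.

Section independence.
Context dO (Omega : measurableType dO) (R : realType) (P : probability Omega R).
Context (I : finType) (d : I -> nat).
Variable X : forall p : I, Omega -> 'cV[R]_(d p).
Hypothesis rX : forall p, random_vector (X p).
Hypothesis iX : mutually_independent P X.

(** Nonnegativity makes monotone convergence available in the product formula. *)
Definition adapted p (f : Omega -> R) :=
  exists h : cV_measurableType R (d p) -> R,
    [/\ measurable_fun setT h, (forall v, 0 <= h v) & f = h \o X p].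

Lemma adapted_measurable p f : adapted p f -> measurable_fun setT f.
Proof.
move=> [h [mh _ ->]]; apply: measurableT_comp => //.
exact: measurable_random_vector.
Qed.

Lemma adapted_ge0 p f : adapted p f -> forall w, 0 <= f w.
Proof. by move=> [h [_ h0 ->]] w /=. Qed.

Lemma adapted_indic p (B : set 'cV[R]_(d p)) :
  borel_cV B -> adapted p (\1_(X p @^-1` B)).
Proof.
move=> mB; exists (\1_B : 'cV[R]_(d p) -> R); split => //.
Qed.

Lemma adapted1 p : adapted p (cst 1).
Proof. by exists (cst 1). Qed.

Lemma adaptedM p f g : adapted p f -> adapted p g ->
  adapted p (fun w => f w * g w).
Proof.
move=> [h [mh h0 ->]] [k [mk k0 ->]]; exists (fun v => h v * k v); split => //.
- exact: measurable_funM.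
- by move=> v; rewrite mulr_ge0.
Qed.

(** For indicators this is mutual independence.  The indicators are then
    replaced by general factors one at a time, along [r]: with [W] the product
    of the other factors, the identity for all indicators of the factor [p0]
    says that two measures on the line coincide. *)
Lemma integral_prod_adapted (r : seq I) (f : I -> Omega -> R) (e : I -> R) :
  (forall p, adapted p (f p)) ->
  (forall p, \int[P]_w (f p w)%:E = (e p)%:E)%E ->
  (forall p, p \notin r ->
     exists2 B : set 'cV[R]_(d p), borel_cV B & f p = \1_(X p @^-1` B)) ->
  (\int[P]_w (\prod_p f p w)%:E = (\prod_p e p)%:E)%E.
Proof.
elim: r f e => [|p0 r IH] f e fA fe fr.
  pose B p := s2val (cid2 (fr p isT)).
  have mB p : borel_cV (B p) by rewrite /B; case: cid2.
  have fB p : f p = \1_(X p @^-1` B p) by rewrite /B; case: cid2.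
  have mXB p : measurable (X p @^-1` B p).
    have := measurable_random_vector (@rX p) measurableT (mB p).
    by rewrite setTI.
  transitivity (\int[P]_w (\1_(\bigcap_(p in [set: I]) (X p @^-1` B p)) w)%:E)%E.
    apply: eq_integral => w _; congr EFin.
    rewrite indicE; case: (boolP (w \in _)) => [/set_mem wB|wB].
      rewrite big1// => p _; rewrite fB indicE mem_set//; exact: wB.
    have [p wp] : exists p, ~ (X p @^-1` B p) w.
      apply/existsNP => H; move/negP: wB; apply; rewrite inE => p _; exact: H.
    rewrite (bigD1 p)//= fB indicE memNset// mul0r//.
  rewrite integral_indic//; last by apply: fin_bigcap_measurable.
  rewrite setIT; apply: (etrans (iX mB)).
  rewrite -prodEFin; apply: eq_bigr => p _.
  by rewrite -fe fB integral_indic// setIT.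
pose W w := \prod_(p | p != p0) f p w.
pose c := \prod_(p | p != p0) e p.
have e0 p : 0 <= e p.
  rewrite -lee_fin -fe integral_ge0// => w _.
  by rewrite lee_fin (adapted_ge0 (fA p)).
have c0 : 0 <= c by exact: prodr_ge0.
have mf p : measurable_fun setT (f p) := adapted_measurable (fA p).
have W0 w : 0 <= W w by apply: prodr_ge0 => p _; exact: (adapted_ge0 (fA p)).
have mW : measurable_fun setT W.
  rewrite /W; under eq_fun do rewrite big_mkcond/=.
  by apply: measurable_prod => p _; case: (p != p0).
have [h [mh h0 fh]] := fA p0.
have key (B : set R) : measurable B ->
    (c%:E * P (f p0 @^-1` B) = \int[P]_w (W w * \1_B (f p0 w))%:E)%E.
  move=> mB; pose D := h @^-1` B.
  have mD : borel_cV D by have := mh measurableT B mB; rewrite setTI.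
  have mfB : measurable (f p0 @^-1` B).
    by have := mf p0 measurableT B mB; rewrite setTI.
  have fBD : f p0 @^-1` B = X p0 @^-1` D by rewrite fh.
  pose f' p := if p == p0 then \1_(f p0 @^-1` B) else f p.
  pose e' p := if p == p0 then fine (P (f p0 @^-1` B)) else e p.
  have := IH f' e'; rewrite (bigD1 p0)//= {2}/e' eqxx.
  have -> : \prod_(p | p != p0) e' p = c.
    by apply: eq_bigr => p /negPf pp0; rewrite /e' pp0.
  rewrite EFinM fineK ?fin_num_measure// muleC => <-.
  - apply: eq_integral => w _; congr EFin.
    rewrite (bigD1 p0)//= mulrC /f' eqxx; congr (_ * _).
    by apply: eq_bigr => p /negPf ->.
  - move=> p; rewrite /f'; case: eqP => // ->.
    by rewrite fBD; exact: adapted_indic.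
  - move=> p; rewrite /f' /e'; case: eqP => // _.
    by rewrite integral_indic// setIT fineK// fin_num_measure.
  - move=> p pr; rewrite /f'; case: eqP => [->|/eqP pp0].
      by exists D => //; rewrite fBD.
    by apply: fr; rewrite inE negb_or pp0.
pose nu0 := mscale (NngNum c0) (pushforward P (f p0)).
pose nu := nu0 (mf p0).
have mnorm : measurable_fun [set: R] (@Num.norm R R) by [].
have nuE (B : set R) : measurable B ->
    (nu B = \int[P]_w (W w * \1_B (f p0 w))%:E)%E.
  by move=> mB; rewrite -key.
have := @ge0_integral_density _ _ _ _ _ P nu _ _ (mf p0) mW W0 nuE
  (@Num.norm R R) mnorm (fun=> normr_ge0 _).
rewrite /nu /nu0 ge0_integral_mscale//; last exact/measurable_EFinP.
rewrite ge0_integral_pushforward//; last exact/measurable_EFinP.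
rewrite preimage_setT/= => H.
transitivity (\int[P]_w (W w * `|f p0 w|)%:E)%E.
  apply: eq_integral => w _; congr EFin.
  by rewrite (bigD1 p0)//= mulrC ger0_norm// (adapted_ge0 (fA p0)).
rewrite -H [RHS](congr1 EFin (bigD1 p0 _))//= mulrC EFinM; congr (_ * _)%E.
rewrite -fe; apply: eq_integral => w _ /=.
by rewrite ger0_norm// (adapted_ge0 (fA p0)).
Qed.

End independence.

(** * The algebra spanned by such products *)

Section tame_span.
Context dO (Omega : measurableType dO) (R : realType) (P : probability Omega R).
Context (I : finType) (d : I -> nat).
Variable X : forall p : I, Omega -> 'cV[R]_(d p).

(** All moments are required so that products of tame factors stay tame. *)
Definition tame p (f : Omega -> R) :=
  adapted X p f /\
  forall k, P.-integrable setT (EFin \o (fun w => f w ^+ k)).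

(** Variables that depend only on the vectors indexed by [A], in a form to which
    independence applies directly.  The factors are nonnegative, as in
    [integral_prod_adapted]; the signs are carried by the coefficients [c].  The
    span is an algebra, and contains the centred coordinates. *)
Inductive tame_span (A : {set I}) : (Omega -> R) -> Prop :=
| tame_span_prod c f : (forall p, tame p (f p)) ->
    (forall p, p \notin A -> f p = cst 1) ->
    tame_span A (fun w => c * \prod_p f p w)
| tame_span_add F G : tame_span A F -> tame_span A G -> tame_span A (fun w => F w + G w).

Definition expect (F : Omega -> R) : R := \int[P]_w F w.

Hypothesis rX : forall p, random_vector (X p).

Lemma tame_measurable p f : tame p f -> measurable_fun setT f.
Proof. by move=> [/(adapted_measurable rX)]. Qed.

Lemma tame1 p : tame p (cst 1).
Proof.
split; first exact: adapted1.
move=> k; rewrite [X in _.-integrable _ X](_ : _ = cst 1%:E).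
  exact: finite_measure_integrable_cst.
by apply/funext => w /=; rewrite expr1n.
Qed.

Lemma tameM p f g : tame p f -> tame p g -> tame p (fun w => f w * g w).
Proof.
move=> fg gg; have mf := tame_measurable fg; have mg := tame_measurable gg.
move: fg gg => [fA fi] [gA gi]; split; first exact: adaptedM.
move=> k.
apply: (@le_integrable _ _ _ _ _ _ _
  ((EFin \o (fun w => (f w ^+ (k * 2))%R)) \+ (EFin \o (fun w => (g w ^+ (k * 2))%R)))%E).
- exact: measurableT.
- apply/measurable_EFinP; apply: measurable_funX; exact: measurable_funM.
- move=> w _ /=; have f0 := adapted_ge0 fA w; have g0 := adapted_ge0 gA w.
  rewrite lee_fin exprMn !exprM.
  set a := f w ^+ k; set b := g w ^+ k.
  have a0 : 0 <= a by exact: exprn_ge0.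
  have b0 : 0 <= b by exact: exprn_ge0.
  rewrite !ger0_norm ?addr_ge0 ?sqr_ge0 ?mulr_ge0//.
  nra.
- by apply: integrableD.
Qed.

Lemma eq_tame_span A F G : F =1 G -> tame_span A F -> tame_span A G.
Proof. by move=> /funext ->. Qed.

Lemma tame_spanM A F G : tame_span A F -> tame_span A G -> tame_span A (fun w => F w * G w).
Proof.
move=> sF sG; elim: sF => {F}[c f fg f1|F1 F2 _ IH1 _ IH2]; last first.
  apply: (eq_tame_span _ (tame_span_add IH1 IH2)) => w /=; by rewrite mulrDl.
elim: sG => {G}[c' g gg g1|G1 G2 _ IH1 _ IH2]; last first.
  apply: (eq_tame_span _ (tame_span_add IH1 IH2)) => w /=; by rewrite mulrDr.
have := @tame_span_prod A (c * c') (fun p w => f p w * g p w).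
move=> /(_ _ _)/eq_tame_span; apply.
- by move=> w; rewrite big_split/= mulrACA.
- by move=> p; exact: tameM.
- by move=> p pA; apply/funext => w /=; rewrite f1// g1//= mulr1.
Qed.

Lemma tame_span_cst A c : tame_span A (cst c).
Proof.
have := @tame_span_prod A c (fun _ => cst 1) tame1 (fun _ _ => erefl).
by apply: eq_tame_span => w /=; rewrite big1 ?mulr1.
Qed.

Lemma tame_spanZ A c F : tame_span A F -> tame_span A (fun w => c * F w).
Proof. by move=> sF; exact: (tame_spanM (tame_span_cst A c) sF). Qed.

Lemma tame_spanN A F : tame_span A F -> tame_span A (fun w => - F w).
Proof. by move=> /(tame_spanZ (-1)); apply: eq_tame_span => w; rewrite mulN1r. Qed.

Lemma tame_spanX A F k : tame_span A F -> tame_span A (fun w => F w ^+ k).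
Proof.
move=> sF; elim: k => [|k IH]; first exact: tame_span_cst.
by apply: (eq_tame_span _ (tame_spanM sF IH)) => w; rewrite exprS.
Qed.

Lemma tame_span_sum A (J : Type) (r : seq J) (Q : pred J) (F : J -> Omega -> R) :
  (forall j, Q j -> tame_span A (F j)) -> tame_span A (fun w => \sum_(j <- r | Q j) F j w).
Proof.
move=> sF; elim: r => [|j r IH].
  by apply: (eq_tame_span _ (tame_span_cst A 0)) => w; rewrite big_nil.
case/boolP: (Q j) => Qj.
  by apply: (eq_tame_span _ (tame_span_add (sF j Qj) IH)) => w; rewrite big_cons Qj.
by apply: (eq_tame_span _ IH) => w; rewrite big_cons (negPf Qj).
Qed.

Lemma tame_span_sub (A B : {set I}) F : A \subset B -> tame_span A F -> tame_span B F.
Proof.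
move=> /fintype.subsetP AB; elim=> [c f fg f1|F1 F2 _ IH1 _ IH2].
  by apply: tame_span_prod => // p pB; apply: f1; apply: contra pB; exact: AB.
exact: tame_span_add.
Qed.

Lemma tame_span_setT A F : tame_span A F -> tame_span [set: I]%SET F.
Proof. by apply: tame_span_sub; apply/fintype.subsetP => x; rewrite finset.inE. Qed.

(** Write [h] as the difference of its positive and negative parts; the even
    moments suffice since |t|^k <= 1 + t^(2k). *)
Lemma tame_span_fun p (A : {set I}) (h : cV_measurableType R (d p) -> R) :
  p \in A -> measurable_fun setT h ->
  (forall k, P.-integrable setT (EFin \o (fun w => h (X p w) ^+ (2 * k)))) ->
  tame_span A (fun w => h (X p w)).
Proof.
move=> pA mh hi.
have mhX : measurable_fun setT (h \o X p).
  by apply: measurableT_comp => //; exact: measurable_random_vector.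
have part (h' : cV_measurableType R (d p) -> R) : measurable_fun setT h' ->
    (forall v, 0 <= h' v <= `|h v|) -> tame_span A (h' \o X p).
  move=> mh' h'b.
  have mhX' : measurable_fun setT (h' \o X p).
    by apply: measurableT_comp => //; exact: measurable_random_vector.
  have gh : tame p (h' \o X p).
    split.
      by exists h'; split => // v; have /andP[] := h'b v.
    move=> k; apply: (@le_integrable _ _ _ _ _ _ _
      (cst 1%:E \+ (EFin \o (fun w => (h (X p w) ^+ (2 * k))%R)))%E).
    - exact: measurableT.
    - by apply/measurable_EFinP; exact: measurable_funX.
    - move=> w _ /=; have /andP[h'0 h'h] := h'b (X p w).
      rewrite lee_fin ger0_norm ?exprn_ge0// mulnC exprM.
      rewrite ger0_norm ?addr_ge0 ?sqr_ge0//.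
      apply: (@le_trans _ _ (`|h (X p w)| ^+ k)).
        by rewrite lerXn2r ?nnegrE.
      rewrite -normrX; set a := h _ ^+ k.
      rewrite -(real_normK (num_real a)).
      have := normr_ge0 a; nra.
    - apply: integrableD => //.
      exact: finite_measure_integrable_cst.
  pose f q := if q == p then h' \o X p else cst 1.
  have := @tame_span_prod A 1 f; move=> /(_ _ _)/eq_tame_span; apply.
  - move=> w; rewrite mul1r (bigD1 p)//= /f eqxx big1 ?mulr1// => q /negPf ->//.
  - move=> q; rewrite /f; case: eqP => [->//|_]; exact: tame1.
  - move=> q qA; rewrite /f; case: eqP => // qp; move: qA; rewrite qp pA//.
have mm : measurable_fun setT (fun v => - h v) by exact: measurable_funN.
have s1 := part (fun v => Num.max (h v) 0).
have s2 := part (fun v => Num.max (- h v) 0).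
have m1 : measurable_fun setT (fun v => Num.max (h v) 0).
  by apply: measurable_maxr.
have m2 : measurable_fun setT (fun v => Num.max (- h v) 0).
  by apply: measurable_maxr.
have {}s1 := s1 m1 _.
have {}s2 := s2 m2 _.
apply: (eq_tame_span _ (tame_span_add (s1 _) (tame_spanN (s2 _)))).
- move=> w /=; case: (lerP (h (X p w)) 0) => hw.
    by rewrite max_l ?oppr_ge0// opprK add0r.
  by rewrite max_r ?oppr_le0 ?ltW// subr0.
- move=> v; case: (lerP (h v) 0) => hv; first by rewrite lexx normr_ge0.
  by rewrite ltW//= ler_norm.
- move=> v; case: (lerP (- h v) 0) => hv; first by rewrite lexx normr_ge0.
  by rewrite ltW//= -normrN ler_norm.
Qed.

Hypothesis iX : mutually_independent P X.

Lemma expect_prod_tame f : (forall p, tame p (f p)) ->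
  P.-integrable setT (EFin \o (fun w => \prod_p f p w)) /\
  expect (fun w => \prod_p f p w) = \prod_p expect (f p).
Proof.
move=> fg.
have fi p : P.-integrable setT (EFin \o f p).
  have [_ /(_ 1%N)] := fg p.
  by apply: eq_integrable.
have fE p : (\int[P]_w (f p w)%:E = (expect (f p))%:E)%E.
  by rewrite /expect /Rintegral fineK//; apply: integrable_fin_num => //; exact: fi.
have H := @integral_prod_adapted _ _ _ _ _ _ _ rX iX (enum I) f
  (fun p => expect (f p)) (fun p => (fg p).1) fE.
have {}H := H (fun p => _).
have {}H : (\int[P]_w (\prod_p f p w)%:E = (\prod_p expect (f p))%:E)%E.
  by apply: H => p; rewrite mem_enum.
split; last by rewrite /expect /Rintegral H.
have m : measurable_fun setT (fun w => \prod_p f p w).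
  by apply: measurable_prod => p _; exact: tame_measurable.
apply/integrableP; split; first exact/measurable_EFinP.
rewrite (eq_integral (fun w => (\prod_p f p w)%:E)) ?H ?ltry// => w _.
rewrite gee0_abs// lee_fin prodr_ge0// => p _; exact: adapted_ge0 (fg p).1 _.
Qed.

Lemma tame_span_integrable A F : tame_span A F -> P.-integrable setT (EFin \o F).
Proof.
elim=> [c f fg _|F1 F2 _ IH1 _ IH2].
  have [fi _] := expect_prod_tame fg.
  by have := integrableZl measurableT c fi; apply: eq_integrable.
by have := integrableD measurableT IH1 IH2; apply: eq_integrable.
Qed.

Lemma tame_span_measurable A F : tame_span A F -> measurable_fun setT F.
Proof.
by move=> /tame_span_integrable /measurable_int /measurable_EFinP.
Qed.

Lemma tame_span_EFin A F : tame_span A F -> (\int[P]_w (F w)%:E = (expect F)%:E)%E.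
Proof.
move=> /tame_span_integrable Fi.
by rewrite /expect /Rintegral fineK//; apply: integrable_fin_num.
Qed.

Lemma expectD A B F G : tame_span A F -> tame_span B G ->
  expect (fun w => F w + G w) = expect F + expect G.
Proof.
by move=> sF sG; rewrite /expect RintegralD//; 
  [exact: tame_span_integrable sF|exact: tame_span_integrable sG].
Qed.

Lemma expectZ A c F : tame_span A F -> expect (fun w => c * F w) = c * expect F.
Proof. move=> sF; rewrite /expect RintegralZl//; exact: tame_span_integrable sF. Qed.

Lemma expectN A F : tame_span A F -> expect (fun w => - F w) = - expect F.
Proof.
move=> sF; rewrite -[RHS]mulN1r -(expectZ _ sF).
by congr expect; apply/funext => w; rewrite mulN1r.
Qed.

Lemma expectB A B F G : tame_span A F -> tame_span B G ->
  expect (fun w => F w - G w) = expect F - expect G.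
Proof. by move=> sF sG; rewrite -(expectN sG) (expectD sF (tame_spanN sG)). Qed.

Lemma expect_cst c : expect (cst c) = c.
Proof.
rewrite /expect Rintegral_cst// [X in _ * X](_ : _ = 1) ?mulr1//.
by rewrite -[RHS]/(fine 1%:E); congr fine; exact: probability_setT.
Qed.

Lemma expect_sum A (J : Type) (r : seq J) (Q : pred J) (F : J -> Omega -> R) :
  (forall j, Q j -> tame_span A (F j)) ->
  expect (fun w => \sum_(j <- r | Q j) F j w) = \sum_(j <- r | Q j) expect (F j).
Proof.
move=> sF; elim: r => [|j r IH].
  rewrite big_nil -[RHS](expect_cst 0); congr expect; apply/funext => w.
  by rewrite big_nil.
rewrite big_cons; case/boolP: (Q j) => Qj.
  rewrite -IH -(expectD (sF j Qj) (tame_span_sum _ sF)); congr expect; apply/funext => w.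
  by rewrite big_cons Qj.
rewrite -IH; congr expect; apply/funext => w.
by rewrite big_cons (negPf Qj).
Qed.

Lemma expect_ge0 F : (forall w, 0 <= F w) -> 0 <= expect F.
Proof. by move=> F0; apply: Rintegral_ge0. Qed.

Lemma expect_le A B F G : tame_span A F -> tame_span B G -> (forall w, F w <= G w) ->
  expect F <= expect G.
Proof.
move=> sF sG FG; rewrite -subr_ge0 -(expectB sG sF); apply: expect_ge0 => w.
by rewrite subr_ge0.
Qed.

(** By bilinearity it is enough to treat two products, and for every index one
    of the two factors is 1. *)
Lemma expect_indep (A B : {set I}) F G : (forall p, p \in A -> p \notin B) ->
  tame_span A F -> tame_span B G ->
  expect (fun w => F w * G w) = expect F * expect G.
Proof.
move=> AB sF sG.
have sFT : tame_span [set: I]%SET F := tame_span_setT sF.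
have sGT : tame_span [set: I]%SET G := tame_span_setT sG.
elim: sF sFT => {F}[c f fg f1|F1 F2 sF1 IH1 sF2 IH2] sFT; last first.
  rewrite (expectD sF1 sF2) mulrDl -(IH1 (tame_span_setT sF1)) -(IH2 (tame_span_setT sF2)).
  rewrite -(expectD (tame_spanM (tame_span_setT sF1) sGT) (tame_spanM (tame_span_setT sF2) sGT)).
  by congr expect; apply/funext => w; rewrite mulrDl.
elim: sG sGT => {G}[c' g gg g1|G1 G2 sG1 IH1 sG2 IH2] sGT; last first.
  rewrite (expectD sG1 sG2) mulrDr -(IH1 (tame_span_setT sG1)) -(IH2 (tame_span_setT sG2)).
  rewrite -(expectD (tame_spanM sFT (tame_span_setT sG1)) (tame_spanM sFT (tame_span_setT sG2))).
  by congr expect; apply/funext => w; rewrite mulrDr.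
pose fgp p w := f p w * g p w.
have fgg p : tame p (fgp p) by exact: tameM.
have s1 : tame_span [set: I]%SET (fun w => 1 * \prod_p f p w).
  by apply: tame_span_prod => // p; rewrite finset.inE.
have s2 : tame_span [set: I]%SET (fun w => 1 * \prod_p g p w).
  by apply: tame_span_prod => // p; rewrite finset.inE.
have s3 : tame_span [set: I]%SET (fun w => 1 * \prod_p fgp p w).
  by apply: tame_span_prod => // p; rewrite finset.inE.
have e1 F : (fun w => 1 * F w) = F :> (Omega -> R).
  by apply/funext => w; rewrite mul1r.
rewrite e1 in s1; rewrite e1 in s2; rewrite e1 in s3.
rewrite (expectZ _ s1) (expectZ _ s2).
transitivity (expect (fun w => c * c' * \prod_p fgp p w)).
  congr expect; apply/funext => w.
  by rewrite /fgp big_split/= mulrACA.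
rewrite (expectZ _ s3) mulrACA; congr (_ * _).
rewrite (expect_prod_tame fg).2 (expect_prod_tame gg).2 (expect_prod_tame fgg).2 -big_split/=.
apply: eq_bigr => p _; case: (boolP (p \in A)) => pA.
  have pB := AB p pA.
  have gp := g1 p pB; rewrite gp expect_cst mulr1; congr expect; apply/funext => w.
  by rewrite /fgp gp /= mulr1.
have fp := f1 p pA; rewrite fp expect_cst mul1r; congr expect; apply/funext => w.
by rewrite /fgp fp /= mul1r.
Qed.

End tame_span.

(** * Centred variables with bounded kurtosis *)

Section kurt_var.
Context dO (Omega : measurableType dO) (R : realType) (P : probability Omega R).
Context (I : finType) (d : I -> nat).
Variable X : forall p : I, Omega -> 'cV[R]_(d p).
Hypothesis rX : forall p, random_vector (X p).
Hypothesis iX : mutually_independent P X.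

Local Notation tame_span := (tame_span P X).
Local Notation Ex := (expect P).
Implicit Types (A B : {set I}) (F G : Omega -> R) (s t : R).

(** Centred, with variance [s] and a bounded kurtosis.  The constant is the one
    of [gaussian_even_moment_le] for the fourth moment, 2 * 2! * 4^2. *)
Definition kurt_var A s F :=
  [/\ tame_span A F, Ex F = 0, Ex (fun w => F w ^+ 2) = s &
      Ex (fun w => F w ^+ 4) <= 64 * s ^+ 2].

Lemma kurt_var_sub A B s F : A \subset B -> kurt_var A s F -> kurt_var B s F.
Proof. by move=> AB [sF ? ? ?]; split => //; exact: tame_span_sub sF. Qed.

Lemma kurt_var0 A : kurt_var A 0 (cst 0).
Proof.
have E0 n : Ex (fun w => (cst 0 w : R) ^+ n.+1) = 0.
  rewrite -[RHS](expect_cst P 0); congr expect; apply/funext => w /=.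
  by rewrite expr0n.
split; [exact: tame_span_cst|exact: expect_cst|exact: E0|].
by rewrite E0 expr0n mulr0.
Qed.

Lemma kurt_varZ A s F c : kurt_var A s F -> kurt_var A (c ^+ 2 * s) (fun w => c * F w).
Proof.
move=> [sF F0 F2 F4]; split; first exact: tame_spanZ.
- by rewrite (expectZ rX iX c sF) F0 mulr0.
- rewrite -F2 -(expectZ rX iX _ (tame_spanX rX 2 sF)); congr expect; apply/funext => w.
  by rewrite exprMn.
- have -> : (fun w => (c * F w) ^+ 4) = (fun w => c ^+ 4 * F w ^+ 4).
    by apply/funext => w; rewrite exprMn.
  rewrite (expectZ rX iX _ (tame_spanX rX 4 sF)).
  have -> : 64 * (c ^+ 2 * s) ^+ 2 = c ^+ 4 * (64 * s ^+ 2) by ring.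
  by apply: ler_wpM2l => //; rewrite (exprM c 2 2) sqr_ge0.
Qed.

Lemma kurt_var_ge0 A s F : kurt_var A s F -> 0 <= s.
Proof. by move=> [_ _ <- _]; apply: expect_ge0 => w; exact: sqr_ge0. Qed.

(** The odd mixed moments vanish, so that E (F + G)^4 = E F^4 + 6 s t + E G^4,
    and 6 <= 2 * 64. *)
Lemma kurt_varD A B s t F G : (forall p, p \in A -> p \notin B) ->
  kurt_var A s F -> kurt_var B t G ->
  kurt_var (A :|: B)%SET (s + t) (fun w => F w + G w).
Proof.
move=> AB gF gG; have s0 := kurt_var_ge0 gF; have t0 := kurt_var_ge0 gG.
move: gF gG => [sF F0 F2 F4] [sG G0 G2 G4].
have ind i j : Ex (fun w => F w ^+ i * G w ^+ j) =
    Ex (fun w => F w ^+ i) * Ex (fun w => G w ^+ j).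
  by rewrite (expect_indep rX iX AB (tame_spanX rX i sF) (tame_spanX rX j sG)).
have F1 : Ex (fun w => F w ^+ 1) = 0.
  by rewrite -F0; congr expect; apply/funext => w; rewrite expr1.
have G1 : Ex (fun w => G w ^+ 1) = 0.
  by rewrite -G0; congr expect; apply/funext => w; rewrite expr1.
have sFG i j : tame_span [set: I]%SET (fun w => F w ^+ i * G w ^+ j).
  by apply: tame_spanM => //; apply: tame_spanX => //;
    [exact: tame_span_setT sF|exact: tame_span_setT sG].
have sF' i := tame_span_setT (tame_spanX rX i sF).
have sG' i := tame_span_setT (tame_spanX rX i sG).
have sD : tame_span (A :|: B)%SET (fun w => F w + G w).
  by apply: tame_span_add; [apply: tame_span_sub sF; exact: finset.subsetUl|
                       apply: tame_span_sub sG; exact: finset.subsetUr].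
split => //.
- by rewrite (expectD rX iX sF sG) F0 G0 addr0.
- have -> : (fun w => (F w + G w) ^+ 2) =
      (fun w => F w ^+ 2 + (2 * (F w ^+ 1 * G w ^+ 1) + G w ^+ 2)).
    by apply/funext => w; ring.
  rewrite (expectD rX iX (sF' 2) (tame_span_add (tame_spanZ rX 2 (sFG 1 1)%N) (sG' 2))).
  rewrite (expectD rX iX (tame_spanZ rX 2 (sFG 1 1)%N) (sG' 2)).
  by rewrite (expectZ rX iX _ (sFG 1 1)%N) ind F1 F2 G2 mul0r mulr0 add0r.
- have -> : (fun w => (F w + G w) ^+ 4) =
      (fun w => F w ^+ 4 + (4 * (F w ^+ 3 * G w ^+ 1) +
        (6 * (F w ^+ 2 * G w ^+ 2) + (4 * (F w ^+ 1 * G w ^+ 3) + G w ^+ 4)))).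
    by apply/funext => w; ring.
  have h4 := sG' 4.
  have h3 := tame_span_add (tame_spanZ rX 4 (sFG 1 3)%N) h4.
  have h2 := tame_span_add (tame_spanZ rX 6 (sFG 2 2)%N) h3.
  have h1 := tame_span_add (tame_spanZ rX 4 (sFG 3 1)%N) h2.
  rewrite (expectD rX iX (sF' 4) h1) (expectD rX iX (tame_spanZ rX 4 (sFG 3 1)%N) h2).
  rewrite (expectD rX iX (tame_spanZ rX 6 (sFG 2 2)%N) h3).
  rewrite (expectD rX iX (tame_spanZ rX 4 (sFG 1 3)%N) h4).
  rewrite !(expectZ rX iX _ (sFG _ _)) !ind F1 G1 F2 G2 !(mul0r, mulr0) !add0r.
  have := mulr_ge0 s0 t0; nra.
Qed.

(** Here [g] assigns the indices to blocks and [F j] depends on block [j] only,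
    which makes the terms independent. *)
Lemma kurt_var_sum (J : eqType) (g : I -> J) (r : seq J) A (s : J -> R)
    (F : J -> Omega -> R) : uniq r ->
  (forall j, kurt_var [set p in A | g p == j]%SET (s j) (F j)) ->
  kurt_var [set p in A | g p \in r]%SET (\sum_(j <- r) s j)
    (fun w => \sum_(j <- r) F j w).
Proof.
move=> + gF; elim: r => [_|j r IH /= /andP[jr ur]].
  rewrite big_nil [X in kurt_var _ _ X](_ : _ = cst 0); first exact: kurt_var0.
  by apply/funext => w; rewrite big_nil.
rewrite big_cons [X in kurt_var _ _ X](_ : _ =
    (fun w => F j w + \sum_(j <- r) F j w)); last first.
  by apply/funext => w; rewrite big_cons.
apply: kurt_var_sub (kurt_varD _ (gF j) (IH ur)).
  apply/fintype.subsetP => p; rewrite !finset.inE.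
  by case/orP => /andP[-> /=]; [move=> ->|move=> ->; rewrite orbT].
move=> p; rewrite !finset.inE => /andP[_ /eqP ->].
by rewrite (negPf jr) andbF.
Qed.

Lemma dotE n (u v : 'cV[R]_n) : (u^T *m v) 0 0 = \sum_k u k 0 * v k 0.
Proof. by rewrite mxE; apply: eq_bigr => k _; rewrite mxE. Qed.

Lemma bilE n (u v : 'cV[R]_n) (S : 'M[R]_n) :
  (u^T *m S *m v) 0 0 = \sum_i \sum_j u i 0 * v j 0 * S i j.
Proof.
rewrite mxE exchange_big/=; apply: eq_bigr => j _.
rewrite mxE big_distrl/=; apply: eq_bigr => i _.
by rewrite mxE mulrAC.
Qed.

(** The law of a linear form is given only for a nonzero [u]; for [u = 0] both
    sides vanish. *)
Lemma kurt_var_normal p (m : 'cV[R]_(d p)) (S : 'M[R]_(d p)) (u : 'cV[R]_(d p)) :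
  multivariate_normal P m S (X p) -> posdefmx S ->
  kurt_var [set p]%SET ((u^T *m S *m u) 0 0) (fun w => (u^T *m (X p w - m)) 0 0).
Proof.
move=> law [_ pd]; have [->|u0] := eqVneq u 0.
  rewrite trmx0 !mul0mx [X in kurt_var _ X _](_ : _ = 0) ?mxE//.
  rewrite [X in kurt_var _ _ X](_ : _ = cst 0); first exact: kurt_var0.
  by apply/funext => w; rewrite mul0mx mxE.
set v := _ 0 0; have v0 : 0 < v by exact: pd.
pose s := Num.sqrt v; have s0 : 0 < s by rewrite sqrtr_gt0.
have s2 : s ^+ 2 = v by rewrite sqr_sqrtr// ltW.
pose Y w := (u^T *m X p w) 0 0; pose mm := (u^T *m m) 0 0.
have FE : (fun w => (u^T *m (X p w - m)) 0 0) = (fun w => Y w - mm).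
  by apply/funext => w; rewrite mulmxBr mxE; congr (_ + _); rewrite mxE.
pose h (x : cV_measurableType R (d p)) : R := (u^T *m (x : 'cV[R]_(d p))) 0 0 - mm.
have mh : measurable_fun setT h.
  apply: measurable_funB => //; under eq_fun do rewrite dotE.
  apply: measurable_sum => k; apply: measurable_funM => //.
  exact: measurable_coord.
have mhX : measurable_fun setT (h \o X p).
  by apply: measurableT_comp => //; exact: measurable_random_vector.
have mY : measurable_fun setT Y.
  rewrite (_ : Y = fun w => h (X p w) + mm); first exact: measurable_funD.
  by apply/funext => w; rewrite /h subrK.
have lawY (B : set R) : measurable B -> P (Y @^-1` B) = normal_prob mm s B.
  by move=> mB; exact: law.
have mom := gaussian_even_moment_le mY s0 lawY.
have sqr := gaussian_shifted_sqr mY s0 lawY.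
have spF : tame_span [set p]%SET (fun w => Y w - mm).
  apply: (@tame_span_fun _ _ _ _ _ _ _ rX p _ h) => //.
    by rewrite finset.inE.
  move=> k; apply/integrableP; split.
    by apply/measurable_EFinP; exact: measurable_funX.
  apply: le_lt_trans (ltry (2 * k`!%:R * 4 ^+ k * s ^+ (2 * k))).
  apply: le_trans (mom k); rewrite le_eqVlt; apply/orP; left; apply/eqP.
  apply: eq_integral => w _; rewrite gee0_abs// lee_fin exprM exprn_ge0//.
  exact: sqr_ge0.
have E2 : Ex (fun w => (Y w - mm) ^+ 2) = v.
  apply: EFin_inj; rewrite -(tame_span_EFin rX iX (tame_spanX rX 2 spF)).
  have := sqr 0; rewrite expr0n addr0 s2 => <-.
  by apply: eq_integral => w _; rewrite addr0.
rewrite FE; split => //.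
- have : Ex (fun w => (Y w - mm + 1) ^+ 2) = v + 1.
    have sp1 := tame_span_add spF (tame_span_cst P X [set p]%SET 1).
    apply: EFin_inj; rewrite -(tame_span_EFin rX iX (tame_spanX rX 2 sp1)).
    by have := sqr 1; rewrite expr1n s2 => <-.
  have -> : (fun w => (Y w - mm + 1) ^+ 2) =
      (fun w => (Y w - mm) ^+ 2 + (2 * (Y w - mm) + cst 1 w)).
    by apply/funext => w /=; ring.
  have sc := tame_span_cst P X [set p]%SET 1.
  rewrite (expectD rX iX (tame_spanX rX 2 spF) (tame_span_add (tame_spanZ rX 2 spF) sc)).
  rewrite (expectD rX iX (tame_spanZ rX 2 spF) sc) (expectZ rX iX _ spF) expect_cst E2.
  move=> h1; lra.
- rewrite -lee_fin -(tame_span_EFin rX iX (tame_spanX rX 4 spF)).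
  apply: le_trans (mom 2) _; rewrite lee_fin -s2 -exprM.
  have -> : 2`!%:R = 2 :> R by [].
  by rewrite le_eqVlt; apply/orP; left; apply/eqP; ring.
Qed.

End kurt_var.

(** * Vectors with bounded kurtosis *)

Section kurt_vec.
Context dO (Omega : measurableType dO) (R : realType) (P : probability Omega R).
Context (I : finType) (d : I -> nat).
Variable X : forall p : I, Omega -> 'cV[R]_(d p).
Hypothesis rX : forall p, random_vector (X p).
Hypothesis iX : mutually_independent P X.

Local Notation tame_span := (tame_span P X).
Local Notation Ex := (expect P).
Local Notation kurt_var := (kurt_var P X).
Implicit Types (A B : {set I}) (F G : Omega -> R) (s t : R).

(** The Cauchy-Schwarz inequality, by averaging
    2 F G <= t F^2 + t^-1 G^2. *)
Lemma expect_mul_le A F G a b : 0 <= a -> 0 <= b -> tame_span A F -> tame_span A G ->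
  Ex (fun w => F w ^+ 2) <= 64 * a ^+ 2 ->
  Ex (fun w => G w ^+ 2) <= 64 * b ^+ 2 ->
  Ex (fun w => F w * G w) <= 64 * (a * b).
Proof.
move=> a0 b0 sF sG Fa Gb.
have step t : 0 < t ->
    2 * Ex (fun w => F w * G w) <= 64 * (t * a ^+ 2 + t^-1 * b ^+ 2).
  move=> t0; rewrite -(expectZ rX iX 2 (tame_spanM rX sF sG)).
  apply: (@le_trans _ _
    (Ex (fun w => t * F w ^+ 2 + t^-1 * G w ^+ 2))).
    apply: (expect_le rX iX (tame_spanZ rX 2 (tame_spanM rX sF sG))
      (tame_span_add (tame_spanZ rX t (tame_spanX rX 2 sF))
        (tame_spanZ rX t^-1 (tame_spanX rX 2 sG)))).
    move=> w; rewrite -subr_ge0.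
    have -> : t * F w ^+ 2 + t^-1 * G w ^+ 2 - 2 * (F w * G w) =
        t^-1 * (t * F w - G w) ^+ 2 by field; rewrite gt_eqF.
    by rewrite mulr_ge0 ?sqr_ge0// invr_ge0 ltW.
  rewrite (expectD rX iX (tame_spanZ rX t (tame_spanX rX 2 sF))
    (tame_spanZ rX t^-1 (tame_spanX rX 2 sG))).
  rewrite (expectZ rX iX _ (tame_spanX rX 2 sF)) (expectZ rX iX _ (tame_spanX rX 2 sG)).
  rewrite mulrDr mulrCA (mulrCA 64 t^-1); apply: lerD; apply: ler_wpM2l => //.
    exact: ltW.
  by rewrite invr_ge0 ltW.
apply/ler_addgt0Pr => e e0.
(* The optimal t is b / a; shifting both by a small f allows a = 0 or b = 0. *)
pose c := 64 * (a + b + 1); have c0 : 0 < c by rewrite /c; nra.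
pose f := e / c; have f0 : 0 < f by rewrite divr_gt0.
have fc : f * c = e by rewrite /f mulfVK ?gt_eqF.
have af : 0 < a + f by rewrite ltr_wpDl.
have bf : 0 < b + f by rewrite ltr_wpDl.
have := step _ (divr_gt0 bf af).
have i1 : (b + f) / (a + f) * a ^+ 2 <= (b + f) * a.
  rewrite mulrAC ler_pdivrMr// -mulrA ler_wpM2l ?(ltW bf)//; nra.
have i2 : ((b + f) / (a + f))^-1 * b ^+ 2 <= (a + f) * b.
  rewrite invf_div mulrAC ler_pdivrMr// -mulrA ler_wpM2l ?(ltW af)//; nra.
move=> H; move: fc; rewrite /c => fc; nra.
Qed.

(** A vector that behaves like a centred Gaussian one of covariance [S] as far as
    moments of order two and bounds of order four are concerned. *)
Record kurt_vec A n (S : 'M[R]_n) (x : Omega -> 'cV[R]_n) : Prop := KurtVec {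
  kurt_vec_sym : S^T = S;
  kurt_vec_lin : forall u : 'cV[R]_n,
    kurt_var A ((u^T *m S *m u) 0 0) (fun w => (u^T *m x w) 0 0) }.

Lemma kurt_vec_mul A n m (S : 'M[R]_n) x (T : 'M[R]_(m, n)) :
  kurt_vec A S x -> kurt_vec A (T *m S *m T^T) (fun w => T *m x w).
Proof.
move=> [Ss xl]; split; first by rewrite !trmx_mul trmxK Ss mulmxA.
move=> u; have := xl (T^T *m u); rewrite trmx_mul trmxK.
by rewrite !mulmxA; under eq_fun do rewrite -mulmxA.
Qed.

Section kurt_vec_theory.
Variables (A : {set I}) (n : nat) (S : 'M[R]_n) (x : Omega -> 'cV[R]_n).
Hypothesis gx : kurt_vec A S x.

Local Notation ee k := (delta_mx k 0 : 'cV[R]_n).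

Lemma quad_delta k : ((ee k)^T *m S *m ee k) 0 0 = S k k.
Proof. by rewrite trmx_delta -rowE -colE !mxE. Qed.

Lemma dot_delta k (v : 'cV[R]_n) : ((ee k)^T *m v) 0 0 = v k 0.
Proof. by rewrite trmx_delta -rowE !mxE. Qed.

Lemma kurt_vec_coord k : kurt_var A (S k k) (fun w => x w k 0).
Proof.
have := kurt_vec_lin gx (ee k); rewrite quad_delta.
by under eq_fun do rewrite dot_delta.
Qed.

Lemma kurt_vec_tame_span k : tame_span A (fun w => x w k 0).
Proof. by have [] := kurt_vec_coord k. Qed.

(** Polarization of the variances of the linear forms. *)
Lemma kurt_vec_cov k l : Ex (fun w => x w k 0 * x w l 0) = S k l.
Proof.
have [_ _ Ek _] := kurt_vec_coord k; have [_ _ El _] := kurt_vec_coord l.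
have [_ _ + _] := kurt_vec_lin gx (ee k + ee l).
have sk := tame_spanX rX 2 (kurt_vec_tame_span k).
have sl := tame_spanX rX 2 (kurt_vec_tame_span l).
have skl := tame_spanM rX (kurt_vec_tame_span k) (kurt_vec_tame_span l).
have -> : (fun w => (((ee k + ee l)^T *m x w) 0 0) ^+ 2)
  = (fun w => x w k 0 ^+ 2 + (2 * (x w k 0 * x w l 0) + x w l 0 ^+ 2)).
  by apply/funext => w; rewrite raddfD/= mulmxDl mxE !dot_delta; ring.
rewrite (expectD rX iX sk (tame_span_add (tame_spanZ rX 2 skl) sl)).
rewrite (expectD rX iX (tame_spanZ rX 2 skl) sl).
rewrite (expectZ rX iX _ skl) Ek El.
have -> : ((ee k + ee l)^T *m S *m (ee k + ee l)) 0 0 =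
    S k k + S l k + (S k l + S l l).
  rewrite [(_ + _)^T]raddfD/= !(mulmxDr, mulmxDl) !trmx_delta -!rowE -!colE.
  by rewrite !mxE.
have -> : S l k = S k l by rewrite -[in LHS](kurt_vec_sym gx) mxE.
move=> H; lra.
Qed.

Lemma kurt_vec_quad_ge0 (u : 'cV[R]_n) : 0 <= (u^T *m S *m u) 0 0.
Proof. exact: kurt_var_ge0 (kurt_vec_lin gx u). Qed.

Lemma kurt_vec_trace : Ex (fun w => \sum_k x w k 0 ^+ 2) = \tr S.
Proof.
rewrite (expect_sum rX iX _ (fun k _ => tame_spanX rX 2 (kurt_vec_tame_span k))).
by apply: eq_bigr => k _; have [_ _ -> _] := kurt_vec_coord k.
Qed.

Lemma kurt_vec_quartic (u v : 'cV[R]_n) :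
  Ex (fun w => (u^T *m x w) 0 0 ^+ 2 * (v^T *m x w) 0 0 ^+ 2) <=
  64 * ((u^T *m S *m u) 0 0 * (v^T *m S *m v) 0 0).
Proof.
have [su _ _ u4] := kurt_vec_lin gx u; have [sv _ _ v4] := kurt_vec_lin gx v.
apply: (expect_mul_le _ _ (tame_spanX rX 2 su) (tame_spanX rX 2 sv));
  rewrite ?kurt_vec_quad_ge0//.
- by under [X in Ex X]eq_fun do rewrite -exprM.
- by under [X in Ex X]eq_fun do rewrite -exprM.
Qed.

Lemma kurt_vec_trace_sqr : Ex (fun w => (\sum_k x w k 0 ^+ 2) ^+ 2) <= 64 * (\tr S) ^+ 2.
Proof.
have sp k l : tame_span A (fun w => x w k 0 ^+ 2 * x w l 0 ^+ 2).
  by apply: tame_spanM => //; apply: tame_spanX => //; exact: kurt_vec_tame_span.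
have -> : (fun w => (\sum_k x w k 0 ^+ 2) ^+ 2) =
  (fun w => \sum_k \sum_l x w k 0 ^+ 2 * x w l 0 ^+ 2).
  by apply/funext => w; rewrite expr2 big_distrlr.
rewrite (expect_sum rX iX _ (fun k _ => tame_span_sum (index_enum _) (fun l _ => sp k l))).
rewrite expr2 /mxtrace big_distrlr mulr_sumr/=; apply: ler_sum => k _.
rewrite (expect_sum rX iX _ (fun l _ => sp k l)) mulr_sumr; apply: ler_sum => l _.
have := kurt_vec_quartic (ee k) (ee l).
rewrite !quad_delta.
by under [X in Ex X]eq_fun do rewrite !dot_delta.
Qed.

(** The sum is the expectation of the quadratic form [B] at [x], since [S] is
    the matrix of the second moments of [x].  This stands in for a square root
    of [S]. *)
Lemma kurt_vec_dual (B : 'I_n -> 'I_n -> R) :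
  (forall u : 'cV[R]_n, 0 <= \sum_i \sum_j u i 0 * u j 0 * B i j) ->
  0 <= \sum_i \sum_j S i j * B i j.
Proof.
move=> B0.
have spp i j : tame_span A (fun w => x w i 0 * x w j 0).
  by apply: tame_spanM => //; exact: kurt_vec_tame_span.
have sp i j : tame_span A (fun w => B i j * (x w i 0 * x w j 0)) by exact: tame_spanZ.
have -> : \sum_i \sum_j S i j * B i j =
    Ex (fun w => \sum_i \sum_j B i j * (x w i 0 * x w j 0)).
  rewrite (expect_sum rX iX _ (fun k _ => tame_span_sum (index_enum _) (fun l _ => sp k l))).
  apply: eq_bigr => i _; rewrite (expect_sum rX iX _ (fun l _ => sp i l)).
  by apply: eq_bigr => j _; rewrite (expectZ rX iX _ (spp i j)) kurt_vec_cov mulrC.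
apply: expect_ge0 => w; have := B0 (x w).
congr (0 <= _); apply: eq_bigr => i _; apply: eq_bigr => j _.
by rewrite mulrC.
Qed.

End kurt_vec_theory.

End kurt_vec.

(** * Scalar product of two independent vectors *)

Lemma sqr_sum_mul (R : comRingType) (K : finType) (a b : K -> R) :
  (\sum_k a k * b k) ^+ 2 =
  \sum_(p : K * K) (a p.1 * a p.2) * (b p.1 * b p.2).
Proof.
rewrite expr2 big_distrlr/= pair_bigA/=; apply: eq_bigr => p _.
by rewrite mulrACA.
Qed.

Section independent_gvec.
Context dO (Omega : measurableType dO) (R : realType) (P : probability Omega R).
Context (I : finType) (d : I -> nat).
Variable X : forall p : I, Omega -> 'cV[R]_(d p).
Hypothesis rX : forall p, random_vector (X p).
Hypothesis iX : mutually_independent P X.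

Local Notation tame_span := (tame_span P X).
Local Notation Ex := (expect P).
Local Notation kurt_vec := (kurt_vec P X).

Variables (A B : {set I}) (n : nat) (S S' : 'M[R]_n) (x y : Omega -> 'cV[R]_n).
Hypothesis AB : forall p, p \in A -> p \notin B.
Hypothesis gx : kurt_vec A S x.
Hypothesis gy : kurt_vec B S' y.

Let Tr := \sum_i \sum_j S i j * S' i j.

Let xx (p : 'I_n * 'I_n) w := x w p.1 0 * x w p.2 0.
Let yy (p : 'I_n * 'I_n) w := y w p.1 0 * y w p.2 0.

Let sxx p : tame_span A (xx p).
Proof. by apply: tame_spanM => //; exact: (kurt_vec_tame_span gx). Qed.

Let syy p : tame_span B (yy p).
Proof. by apply: tame_spanM => //; exact: (kurt_vec_tame_span gy). Qed.

(** Expanding the square, independence separates the second moments of [x] from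
    those of [y]. *)
Lemma expect_dot_sqr :
  Ex (fun w => (\sum_k x w k 0 * y w k 0) ^+ 2) = Tr.
Proof.
have -> : (fun w => (\sum_k x w k 0 * y w k 0) ^+ 2) =
    (fun w => \sum_p xx p w * yy p w).
  by apply/funext => w; rewrite sqr_sum_mul.
have sp p : tame_span [set: I]%SET (fun w => xx p w * yy p w).
  by apply: tame_spanM => //; [exact: tame_span_setT (sxx p)|exact: tame_span_setT (syy p)].
rewrite (expect_sum rX iX _ (fun p _ => sp p)) /Tr pair_bigA/=.
apply: eq_bigr => p _.
rewrite (expect_indep rX iX AB (sxx p) (syy p)).
by rewrite (kurt_vec_cov rX iX gx) (kurt_vec_cov rX iX gy).
Qed.

(** The quadratic form of [S] at [y]. *)
Let V w := \sum_i \sum_j S i j * (y w i 0 * y w j 0).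

Let expect_bil (c : 'I_n -> 'I_n -> R) G : tame_span B G ->
  \sum_i \sum_j c i j * Ex (fun w => y w i 0 * y w j 0 * G w) =
  Ex (fun w => (\sum_i \sum_j c i j * (y w i 0 * y w j 0)) * G w).
Proof.
move=> sG.
have sp i j : tame_span B (fun w => y w i 0 * y w j 0 * G w).
  by apply: tame_spanM => //; exact: (syy (i, j)).
have spc i j : tame_span B (fun w => c i j * (y w i 0 * y w j 0 * G w)).
  exact: tame_spanZ.
have -> : (fun w => (\sum_i \sum_j c i j * (y w i 0 * y w j 0)) * G w) =
    (fun w => \sum_i \sum_j c i j * (y w i 0 * y w j 0 * G w)).
  apply/funext => w; rewrite mulr_suml; apply: eq_bigr => i _.
  by rewrite mulr_suml; apply: eq_bigr => j _; rewrite -mulrA.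
rewrite (expect_sum rX iX _ (fun i _ => tame_span_sum (index_enum _) (fun j _ => spc i j))).
apply: eq_bigr => i _; rewrite (expect_sum rX iX _ (fun j _ => spc i j)).
by apply: eq_bigr => j _; rewrite (expectZ rX iX _ (sp i j)).
Qed.

Let dot_sqr (u : 'cV[R]_n) w : \sum_i \sum_j u i 0 * u j 0 * (y w i 0 * y w j 0) =
  (u^T *m y w) 0 0 ^+ 2.
Proof.
rewrite dotE expr2 big_distrlr; apply: eq_bigr => i _; apply: eq_bigr => j _.
by rewrite mulrACA.
Qed.

Let sdot (u : 'cV[R]_n) : tame_span B (fun w => (u^T *m y w) 0 0).
Proof. by have [] := kurt_vec_lin gy u. Qed.

Let sV : tame_span B V.
Proof.
apply: tame_span_sum => i _; apply: tame_span_sum => j _; apply: tame_spanZ => //.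
exact: (syy (i, j)).
Qed.

(** For fixed vectors [u] and [v], [kurt_vec_quartic] bounds the expectation of
    (v^T y)^2 (u^T y)^2; [kurt_vec_dual] averages this bound over [v = x]. *)
Let V_dot_le (u : 'cV[R]_n) :
  Ex (fun w => V w * (u^T *m y w) 0 0 ^+ 2) <= 64 * Tr * (u^T *m S' *m u) 0 0.
Proof.
set q := (u^T *m S' *m u) 0 0.
have sG := tame_spanX rX 2 (sdot u).
rewrite -(expect_bil S sG) -subr_ge0.
have := kurt_vec_dual rX iX gx (B := fun i j => 64 * q * S' i j -
  Ex (fun w => y w i 0 * y w j 0 * (u^T *m y w) 0 0 ^+ 2)) _.
have -> : 64 * Tr * q - \sum_i \sum_j S i j *
    Ex (fun w => y w i 0 * y w j 0 * (u^T *m y w) 0 0 ^+ 2) =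
    \sum_i \sum_j S i j * (64 * q * S' i j -
  Ex (fun w => y w i 0 * y w j 0 * (u^T *m y w) 0 0 ^+ 2)).
  rewrite mulrAC /Tr mulr_sumr -sumrB; apply: eq_bigr => i _.
  rewrite mulr_sumr -sumrB; apply: eq_bigr => j _.
  by rewrite mulrBr mulrCA.
apply=> v.
have -> : \sum_i \sum_j v i 0 * v j 0 * (64 * q * S' i j -
    Ex (fun w => y w i 0 * y w j 0 * (u^T *m y w) 0 0 ^+ 2)) =
  64 * ((v^T *m S' *m v) 0 0 * q) - \sum_i \sum_j v i 0 * v j 0 *
    Ex (fun w => y w i 0 * y w j 0 * (u^T *m y w) 0 0 ^+ 2).
  rewrite bilE [X in X - _]mulrCA [X in X - _]mulrC mulr_sumr -sumrB; apply: eq_bigr => i _.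
  rewrite mulr_sumr -sumrB; apply: eq_bigr => j _.
  by rewrite mulrBr mulrCA.
rewrite (expect_bil (fun i j => v i 0 * v j 0) sG) subr_ge0.
have := kurt_vec_quartic rX iX gy v u; rewrite -/q.
by under [X in Ex X <= _ -> _]eq_fun do rewrite -dot_sqr.
Qed.

(** The same averaging, now over [u = x] in [V_dot_le]. *)
Let V_sqr_le : Ex (fun w => V w ^+ 2) <= 64 * Tr ^+ 2.
Proof.
under [X in Ex X]eq_fun do rewrite expr2.
rewrite -(expect_bil S sV) -subr_ge0.
have := kurt_vec_dual rX iX gx (B := fun i j => 64 * Tr * S' i j -
  Ex (fun w => y w i 0 * y w j 0 * V w)) _.
have -> : 64 * Tr ^+ 2 - \sum_i \sum_j S i j *
    Ex (fun w => y w i 0 * y w j 0 * V w) =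
    \sum_i \sum_j S i j * (64 * Tr * S' i j -
  Ex (fun w => y w i 0 * y w j 0 * V w)).
  rewrite expr2 mulrA; set c := 64 * Tr; rewrite /Tr mulr_sumr -sumrB; apply: eq_bigr => i _.
  rewrite mulr_sumr -sumrB; apply: eq_bigr => j _.
  by rewrite mulrBr mulrCA.
apply=> v.
have -> : \sum_i \sum_j v i 0 * v j 0 * (64 * Tr * S' i j -
    Ex (fun w => y w i 0 * y w j 0 * V w)) =
  64 * Tr * (v^T *m S' *m v) 0 0 - \sum_i \sum_j v i 0 * v j 0 *
    Ex (fun w => y w i 0 * y w j 0 * V w).
  set c := 64 * Tr; rewrite bilE mulr_sumr -sumrB; apply: eq_bigr => i _.
  rewrite mulr_sumr -sumrB; apply: eq_bigr => j _.
  by rewrite mulrBr mulrCA.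
rewrite (expect_bil (fun i j => v i 0 * v j 0) sV) subr_ge0.
have := V_dot_le v.
under [X in Ex X <= _ -> _]eq_fun do rewrite mulrC -dot_sqr.
exact.
Qed.

(** Independence lets [y] be frozen: conditionally, the fourth moment of the
    linear form y^T x is at most 64 (y^T S y)^2, and [V_sqr_le] bounds the
    expectation of the latter.  The freezing is done on the coefficients of the
    quartic form, that is, on the mixed fourth moments of [x]. *)
Lemma expect_dot_quartic_le :
  Ex (fun w => (\sum_k x w k 0 * y w k 0) ^+ 4) <= 64 ^+ 2 * Tr ^+ 2.
Proof.
pose x4 (t : ('I_n * 'I_n) * ('I_n * 'I_n)) w := xx t.1 w * xx t.2 w.
pose y4 (t : ('I_n * 'I_n) * ('I_n * 'I_n)) w := yy t.1 w * yy t.2 w.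
have quart (a b : 'cV[R]_n) : (\sum_k a k 0 * b k 0) ^+ 4 =
    \sum_(t : ('I_n * 'I_n) * ('I_n * 'I_n))
     ((a t.1.1 0 * a t.1.2 0) * (a t.2.1 0 * a t.2.2 0)) *
     ((b t.1.1 0 * b t.1.2 0) * (b t.2.1 0 * b t.2.2 0)).
  by rewrite (exprM _ 2 2) sqr_sum_mul sqr_sum_mul.
have sx4 t : tame_span A (x4 t) by exact: tame_spanM.
have sy4 t : tame_span B (y4 t) by exact: tame_spanM.
have -> : (fun w => (\sum_k x w k 0 * y w k 0) ^+ 4) =
    (fun w => \sum_t x4 t w * y4 t w).
  by apply/funext => w; rewrite quart.
have sp t : tame_span [set: I]%SET (fun w => x4 t w * y4 t w).
  by apply: tame_spanM => //; [exact: tame_span_setT (sx4 t)|exact: tame_span_setT (sy4 t)].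
rewrite (expect_sum rX iX _ (fun p _ => sp p)).
have -> : \sum_t Ex (fun w => x4 t w * y4 t w) =
    Ex (fun w => \sum_t Ex (x4 t) * y4 t w).
  rewrite (expect_sum rX iX _ (fun t _ => tame_spanZ rX (Ex (x4 t)) (sy4 t))).
  apply: eq_bigr => t _.
  by rewrite (expectZ rX iX _ (sy4 t)) (expect_indep rX iX AB (sx4 t) (sy4 t)).
have pw w : \sum_t Ex (x4 t) * y4 t w <= 64 * V w ^+ 2.
  have [_ _ _] := kurt_vec_lin gx (y w).
  have -> : (fun w0 => ((y w)^T *m x w0) 0 0 ^+ 4) =
      (fun w0 => \sum_t y4 t w * x4 t w0).
    by apply/funext => w0; rewrite dotE quart.
  rewrite (expect_sum rX iX _ (fun t _ => tame_spanZ rX (y4 t w) (sx4 t))) bilE.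
  have -> : \sum_i \sum_j y w i 0 * y w j 0 * S i j = V w.
    by apply: eq_bigr => i _; apply: eq_bigr => j _; rewrite mulrC.
  apply: le_trans; rewrite le_eqVlt; apply/orP; left; apply/eqP.
  by apply: eq_bigr => t _; rewrite (expectZ rX iX _ (sx4 t)) mulrC.
apply: le_trans (expect_le rX iX
  (tame_span_sum (index_enum _) (fun t _ => tame_spanZ rX (Ex (x4 t)) (sy4 t)))
  (tame_spanZ rX 64 (tame_spanX rX 2 sV)) pw) _.
rewrite (expectZ rX iX _ (tame_spanX rX 2 sV)) expr2 -mulrA.
by apply: ler_wpM2l => //; exact: V_sqr_le.
Qed.

End independent_gvec.

(** * Averages over partly overlapping index tuples *)

Section ustatistic.
Context dO (Omega : measurableType dO) (R : realType) (P : probability Omega R).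
Context (I : finType) (d : I -> nat).
Variable X : forall p : I, Omega -> 'cV[R]_(d p).
Hypothesis rX : forall p, random_vector (X p).
Hypothesis iX : mutually_independent P X.

Local Notation tame_span := (tame_span P X).
Local Notation Ex := (expect P).

Variables (J : finType) (D : pred J) (A : J -> {set I}) (dj : rel J).
Variables (Q : J -> Omega -> R) (theta K : R) (c c' : nat).
Hypothesis djP : forall q q', dj q q' -> forall p, p \in A q -> p \notin A q'.
Hypothesis Qspan : forall q, D q -> tame_span (A q) (Q q).
Hypothesis Qmean : forall q, D q -> Ex (Q q) = theta.
Hypothesis Qsqr : forall q, D q -> Ex (fun w => Q q w ^+ 2) <= K * theta ^+ 2.
Hypothesis c_gt0 : (0 < c)%N.
Hypothesis cE : (\sum_(q | D q) 1 = c)%N.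
Hypothesis c'E : forall q, D q -> (\sum_(q' | D q' && dj q q') 1 = c')%N.
Hypothesis theta_gt0 : 0 < theta.

(** The average of [Q] over the admissible tuples; [A q] collects the
    observations that enter [Q q], and [dj] is a sufficient condition for two
    tuples to have no observation in common. *)
Definition ustat w := (\sum_(q | D q) Q q w) / c%:R.

Let sQ q : D q -> tame_span [set: I]%SET (Q q).
Proof. by move=> Dq; exact: tame_span_setT (Qspan Dq). Qed.

Lemma tame_span_ustat : tame_span [set: I]%SET ustat.
Proof.
have -> : ustat = fun w => c%:R^-1 * \sum_(q | D q) Q q w.
  by apply/funext => w; rewrite /ustat mulrC.
by apply: tame_spanZ => //; apply: tame_span_sum.
Qed.

Lemma expect_ustat : Ex ustat = theta.
Proof.
have -> : ustat = fun w => c%:R^-1 * \sum_(q | D q) Q q w.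
  by apply/funext => w; rewrite /ustat mulrC.
rewrite (expectZ rX iX _ (tame_span_sum _ sQ)) (expect_sum rX iX _ sQ).
rewrite (eq_bigr _ Qmean) sumr_const -sum1_card.
rewrite -[theta *+ _]mulr_natl.
have -> : (\sum_(i in D) 1 = c)%N by exact: cE.
by rewrite mulKf// pnatr_eq0 -lt0n.
Qed.

Let c'_le : (c' <= c)%N.
Proof.
have [q Dq] : exists q, D q.
  apply/existsP; apply: contraTT c_gt0; rewrite negb_exists => /forallP nD.
  by rewrite -cE big1// => q Dq; move: (nD q); rewrite Dq.
rewrite -(c'E Dq) -cE [X in (X <= _)%N]big_mkcondr/=.
by apply: leq_sum => q' _; case: ifP.
Qed.

Let expect_pair q q' : D q -> D q' ->
  Ex (fun w => Q q w * Q q' w) <=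
  (if dj q q' then 1 else K) * theta ^+ 2.
Proof.
move=> Dq Dq'; case: ifP => [dqq'|_].
  by rewrite (expect_indep rX iX (djP dqq') (Qspan Dq) (Qspan Dq')) !Qmean// mul1r.
have s2 := tame_spanX rX 2 (sQ Dq); have s2' := tame_spanX rX 2 (sQ Dq').
have ss := tame_spanM rX (sQ Dq) (sQ Dq').
have : 2 * Ex (fun w => Q q w * Q q' w) <=
    Ex (fun w => Q q w ^+ 2) + Ex (fun w => Q q' w ^+ 2).
  rewrite -(expectZ rX iX 2 ss) -(expectD rX iX s2 s2').
  apply: (expect_le rX iX (tame_spanZ rX 2 ss) (tame_span_add s2 s2')) => w.
  have := sqr_ge0 (Q q w - Q q' w); nra.
have := Qsqr Dq; have := Qsqr Dq'; lra.
Qed.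

Let expect_ustat_sqr : Ex (fun w => ustat w ^+ 2) <=
  (c'%:R / c%:R + K * (1 - c'%:R / c%:R)) * theta ^+ 2.
Proof.
have c0 : c%:R != 0 :> R by rewrite pnatr_eq0 -lt0n.
have -> : (fun w => ustat w ^+ 2) = (fun w => c%:R^-1 ^+ 2 *
    \sum_(q | D q) \sum_(q' | D q') Q q w * Q q' w).
  apply/funext => w; rewrite /ustat exprMn mulrC; congr (_ * _).
  by rewrite expr2 big_distrlr.
have ss q q' : D q -> D q' -> tame_span [set: I]%SET (fun w => Q q w * Q q' w).
  by move=> Dq Dq'; exact: (tame_spanM rX (sQ Dq) (sQ Dq')).
have ss1 q : D q -> tame_span [set: I]%SET
    (fun w => \sum_(q' | D q') Q q w * Q q' w).
  by move=> Dq; apply: tame_span_sum => q' Dq'; exact: ss.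
rewrite (expectZ rX iX _ (tame_span_sum _ ss1)) (expect_sum rX iX _ ss1).
apply: (@le_trans _ _ (c%:R^-1 ^+ 2 * \sum_(q | D q)
    ((c'%:R + K * (c%:R - c'%:R)) * theta ^+ 2))); last first.
  rewrite sumr_const -sum1_card.
  have -> : (\sum_(i in D) 1 = c)%N by exact: cE.
  rewrite -[_ * theta ^+ 2 *+ _]mulr_natl le_eqVlt; apply/orP; left; apply/eqP; field.
  exact: c0.
apply: ler_wpM2l; first exact: sqr_ge0.
apply: ler_sum => q Dq.
rewrite (expect_sum rX iX _ (fun q' Dq' => ss q q' Dq Dq')).
apply: le_trans (ler_sum _ (fun q' Dq' => expect_pair Dq Dq')) _.
rewrite -mulr_suml; apply: ler_wpM2r; first exact: sqr_ge0.
rewrite (bigID (dj q))/=.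
rewrite (eq_bigr (fun=> 1)); last by move=> q' /andP[_ ->].
rewrite [X in _ + X](eq_bigr (fun=> K)); last by move=> q' /andP[_ /negPf ->].
rewrite !sumr_const -!sum1_card.
have -> : (\sum_(i in [pred q' | D q' && dj q q']) 1 = c')%N by exact: c'E.
have -> : (\sum_(i in [pred q' | D q' && ~~ dj q q']) 1 = c - c')%N.
  rewrite -cE [in RHS](bigID (dj q))/= -(c'E Dq) addKn//.
by rewrite -[K *+ _]mulr_natl natrB// [_ * K]mulrC.
Qed.

(** In the double sum for the second moment, the c * c' disjoint pairs contribute
    exactly theta^2 each, which the square of the mean removes; each of the other
    pairs contributes at most K theta^2. *)
Lemma expect_ustat_var :
  Ex (fun w => (ustat w / theta - 1) ^+ 2) <= K * (1 - c'%:R / c%:R).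
Proof.
have t0 : theta != 0 by rewrite gt_eqF.
have -> : (fun w => (ustat w / theta - 1) ^+ 2) =
   (fun w => theta^-1 ^+ 2 * ustat w ^+ 2 +
     ((- 2 / theta) * ustat w + cst 1 w)).
  by apply/funext => w /=; field.
have s2 := tame_spanX rX 2 tame_span_ustat.
have s3 := tame_spanZ rX (- 2 / theta) tame_span_ustat.
have s4 := tame_span_cst P X [set: I]%SET 1.
rewrite (expectD rX iX (tame_spanZ rX (theta^-1 ^+ 2) s2) (tame_span_add s3 s4)).
rewrite (expectD rX iX s3 s4) (expectZ rX iX _ s2) (expectZ rX iX _ tame_span_ustat) expect_cst.
rewrite expect_ustat.
have t2 : 0 <= theta^-1 ^+ 2 by exact: sqr_ge0.
have := ler_wpM2l t2 expect_ustat_sqr.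
set rho := c'%:R / c%:R.
have rho1 : rho <= 1.
  by rewrite ler_pdivrMr ?ltr0n// mul1r ler_nat.
have -> : theta^-1 ^+ 2 * ((rho + K * (1 - rho)) * theta ^+ 2) =
   rho + K * (1 - rho) by field.
have -> : - 2 / theta * theta = - 2 by field.
move=> h; lra.
Qed.

End ustatistic.

(** * Counting index tuples *)

Section counting.
Local Open Scope nat_scope.

(** Distributivity for dependent functions: it reduces the count of tuples of
    index vectors to one count in each group. *)
Lemma dffun_distr (I : finType) (T : I -> finType) (F : forall i, T i -> nat) :
  \sum_(l : {dffun forall i, T i}) \prod_i F i (l i) = \prod_i \sum_(x : T i) F i x.
Proof.
rewrite (reindex (@dffun_of_fprod I T)); last first.
  exact: onW_bij (dffun_of_fprod_bij T).
pose F' i := [ffun x => F i x].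
transitivity (\sum_(t : fprod T) \prod_(i in I) F' i (t i)).
  by apply: eq_bigr => t _; apply: eq_bigr => i _; rewrite !ffunE.
rewrite big_fprod.
apply: (etrans (esym (@bigA_distr_big_dep nat 0 1 muln addn I {i & T i}
  (fun i => tagged_with T i) (fun i j => untag 0 (F' i) j)))).
apply: eq_bigr => i _; apply: (etrans (esym (@big_tag nat 0 addn I T
  (fun i => F' i) i))).
by apply: eq_bigr => x _; rewrite ffunE.
Qed.

Lemma forall_natE (I : finType) (b : I -> bool) :
  ([forall i, b i] : nat) = \prod_i (b i : nat).
Proof.
case: forallP => [bT|bF]; first by rewrite big1// => i _; rewrite bT.
have [i /negP/negPf bi] : exists i, ~ b i by apply/existsNP.
by rewrite (bigD1 i)//= bi mul0n.
Qed.

Lemma count_pairs (I : finType) (T : I -> finType)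
    (G : forall i, T i -> T i -> bool) :
  \sum_(q : {dffun forall i, T i} * {dffun forall i, T i}
     | [forall i, G i (q.1 i) (q.2 i)]) 1 =
  \prod_i \sum_(x : T i) \sum_(y : T i) (G i x y : nat).
Proof.
rewrite big_mkcond/=.
rewrite -(pair_bigA _ (fun l1 l2 : {dffun forall i, T i} =>
  if [forall i, G i (l1 i) (l2 i)] then 1 else 0))/=.
rewrite -dffun_distr; apply: eq_bigr => l1 _.
rewrite -(dffun_distr (fun i y => G i (l1 i) y : nat)); apply: eq_bigr => l2 _.
by rewrite -forall_natE; case: [forall i, _].
Qed.

Lemma count_quads (I : finType) (T : I -> finType)
    (G : forall i, T i -> T i -> T i -> T i -> bool) :
  let IV := {dffun forall i, T i} in
  \sum_(q : IV * (IV * (IV * IV))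
     | [forall i, G i (q.1 i) (q.2.1 i) (q.2.2.1 i) (q.2.2.2 i)]) 1 =
  \prod_i \sum_(x : T i) \sum_(y : T i) \sum_(z : T i) \sum_(t : T i)
    (G i x y z t : nat).
Proof.
move=> IV; rewrite big_mkcond/=.
pose f (l1 l2 l3 l4 : IV) :=
  if [forall i, G i (l1 i) (l2 i) (l3 i) (l4 i)] then 1 else 0.
rewrite -(pair_bigA _ (fun (l1 : IV) (q : IV * (IV * IV)) => f l1 q.1 q.2.1 q.2.2))/=.
rewrite -dffun_distr; apply: eq_bigr => l1 _.
rewrite -(pair_bigA _ (fun (l2 : IV) (q : IV * IV) => f l1 l2 q.1 q.2))/=.
rewrite -(dffun_distr (fun i y => \sum_z \sum_t (G i (l1 i) y z t : nat))).
apply: eq_bigr => l2 _.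
rewrite -(pair_bigA _ (fun l3 l4 => f l1 l2 l3 l4))/=.
rewrite -(dffun_distr (fun i z => \sum_t (G i (l1 i) (l2 i) z t : nat))).
apply: eq_bigr => l3 _.
rewrite -(dffun_distr (fun i t => G i (l1 i) (l2 i) (l3 i) t : nat)).
apply: eq_bigr => l4 _.
by rewrite -forall_natE /f; case: [forall i, _].
Qed.

(** Exchanging [x] and [y] shows that twice the count is the number of pairs of
    distinct elements. *)
Lemma count_ordered_pairs m (C : {set 'I_m}) :
  \sum_(x : 'I_m) \sum_(y : 'I_m) ([&& x < y, x \in C & y \in C] : nat) =
  'C(#|C|, 2).
Proof.
apply/eqP; rewrite -(eqn_pmul2r (isT : 0 < 2)).
rewrite -[in X in _ == X](ffactnn 2 : 2`! = 2) bin_ffact !ffactnS ffactn0.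
set L := \sum_(x : 'I_m) _.
have LE : L = \sum_(x : 'I_m) \sum_(y : 'I_m) ([&& y < x, x \in C & y \in C] : nat).
  rewrite /L exchange_big/=; apply: eq_bigr => x _; apply: eq_bigr => y _.
  by rewrite [in RHS]andbCA andbA andbC andbA andbC.
rewrite mulnS muln1 {2}LE -big_split/= muln1.
apply/eqP; transitivity (\sum_(x in C) #|C|.-1).
  rewrite [RHS]big_mkcond/=; apply: eq_bigr => x _; rewrite -big_split/=.
  case: (boolP (x \in C)) => xC; last first.
    by rewrite big1// => y _; rewrite /= !andbF.
  have -> : #|C|.-1 = #|C :\ x|%SET by rewrite (cardsD1 x C) xC.
  rewrite -sum1_card [RHS]big_mkcond/=; apply: eq_bigr => y _.
  rewrite !finset.inE /=; case: (y \in C) => /=; last by rewrite !andbF.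
  by rewrite !andbT -(inj_eq val_inj)/=; case: ltngtP.
by rewrite sum_nat_const.
Qed.

(** A first ordered pair, then a second one outside it:
    'C(m, 2) * 'C(m - 2, 2) = 6 * 'C(m, 4). *)
Lemma count_ordered_quads m (C : {set 'I_m}) :
  \sum_(x : 'I_m) \sum_(y : 'I_m) \sum_(z : 'I_m) \sum_(t : 'I_m)
    ([&& uniq [:: x; y; z; t], x < y, z < t &
       all (fun v => v \in C) [:: x; y; z; t]] : nat) =
  6 * 'C(#|C|, 4).
Proof.
transitivity (\sum_(x : 'I_m) \sum_(y : 'I_m) [&& x < y, x \in C & y \in C] *
   'C(#|C| - 2, 2)).
  apply: eq_bigr => x _; apply: eq_bigr => y _.
  case: (boolP [&& _, _ & _]) => [/and3P[xy xC yC]|nxy]; last first.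
    rewrite mul0n big1// => z _; rewrite big1// => t _.
    apply/eqP; rewrite eqb0; apply: contra nxy.
    by move=> /and4P[_ -> _ /= /and5P[-> ->]].
  rewrite mul1n.
  have <- : #|C :\: [set x; y]|%SET = #|C| - 2.
    have := cardsD C [set x; y]%SET.
    rewrite (finset.setIidPr _); first by rewrite cards2 -(inj_eq val_inj)/= (ltn_eqF xy).
    by apply/fintype.subsetP => v; rewrite !finset.inE => /orP[] /eqP ->.
  rewrite -count_ordered_pairs.
  apply: eq_bigr => z _; apply: eq_bigr => t _; congr nat_of_bool.
  rewrite /= xC yC xy /= !finset.inE !negb_or.
  have -> : x != y by rewrite -(inj_eq val_inj)/= (ltn_eqF xy).
  rewrite (eq_sym x z) (eq_sym x t) (eq_sym y z) (eq_sym y t).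
  case: (ltnP z t) => zt; last by rewrite !andbF.
  have -> : z != t by rewrite -(inj_eq val_inj)/= (ltn_eqF zt).
  by case: (z == x); case: (z == y); case: (t == x); case: (t == y);
    case: (z \in C); case: (t \in C).
under eq_bigr do rewrite -big_distrl/=.
rewrite -big_distrl/= count_ordered_pairs.
apply/eqP; rewrite -(eqn_pmul2r (isT : 0 < 4)).
have -> : 'C(#|C|, 2) * 'C(#|C| - 2, 2) * 4 =
    ('C(#|C|, 2) * 2`!) * ('C(#|C| - 2, 2) * 2`!).
  by rewrite mulnACA.
have -> : 6 * 'C(#|C|, 4) * 4 = 'C(#|C|, 4) * 4`! by rewrite mulnAC mulnC.
rewrite !bin_ffact !ffactnS !ffactn0 !muln1 -!subn1 -!subnDA.
by rewrite !mulnA.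
Qed.

(** The bound on [n i] keeps the truncated subtraction n_i - 2k honest. *)
Lemma prod_bin_ratio (R : realType) (k a : nat) (n : 'I_a -> nat) c :
  0 < c -> (forall i, 2 * k <= n i) ->
  ((\prod_i (c * 'C(n i - k, k)))%:R / (\prod_i (c * 'C(n i, k)))%:R =
   fact_ratio R k n)%R.
Proof.
move=> c0 nk; rewrite /fact_ratio !natr_prod -prodfV -big_split/=.
apply: eq_bigr => i _.
have kn : k <= n i by apply: leq_trans (nk i); rewrite leq_pmull.
have kn' : k <= n i - k by rewrite leq_subRL// addnn -mul2n.
have f0 m : (m`!%:R != 0 :> R)%R by rewrite pnatr_eq0 -lt0n fact_gt0.
have e1 := bin_fact kn; have e2 := bin_fact kn'.
have e3 : n i - k - k = n i - 2 * k by rewrite -subnDA addnn mul2n.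
rewrite e3 in e2.
have b0 : ('C(n i, k)%:R != 0 :> R)%R by rewrite pnatr_eq0 -lt0n bin_gt0.
have cR : (c%:R != 0 :> R)%R by rewrite pnatr_eq0 -lt0n.
have b0' : ('C(n i - k, k)%:R != 0 :> R)%R by rewrite pnatr_eq0 -lt0n bin_gt0.
rewrite -e1 -e2 !natrM; field.
by rewrite !f0 b0 b0' cR.
Qed.

End counting.

(** * The observed differences *)

Section model_differences.
Context (R : realType) (a : nat) (n : 'I_a -> nat) (M : model R n).

Let N : nat := (\sum_(i < a) n i)%N.
Local Notation D := (\sum_(i < a) gdim M i)%N.

Definition obs_family (p : {i : 'I_a & 'I_(n i)}) := obs M (tag p) (tagged p).

Lemma obs_family_random p : random_vector (obs_family p).
Proof. exact: obs_random. Qed.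

Lemma obs_family_indep : mutually_independent (prob M) obs_family.
Proof. exact: obs_indep. Qed.

Local Notation kurt_var := (kurt_var (prob M) obs_family).
Local Notation kurt_vec := (kurt_vec (prob M) obs_family).

Lemma VN_quad (u : 'cV[R]_D) :
  (u^T *m VN M *m u) 0 0 = \sum_(i < a) (N%:R / (n i)%:R) *
    ((submxcol u i)^T *m Sigma M i *m submxcol u i) 0 0.
Proof.
rewrite -[in LHS](submxcolK u) tr_mxcol /VN mul_mxrow_mxdiag mul_mxrow_mxcol.
rewrite summxE; apply: eq_bigr => i _.
by rewrite -scalemxAr -scalemxAl mxE.
Qed.

Lemma VN_sym : (VN M)^T = VN M.
Proof.
rewrite /VN tr_mxdiag; apply: eq_mxdiag => i.
by rewrite linearZ/= (Sigma_posdef M i).1.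
Qed.

Lemma VN_quad_gt0 (u : 'cV[R]_D) : (forall i, (0 < n i)%N) -> u != 0 ->
  0 < (u^T *m VN M *m u) 0 0.
Proof.
move=> n0 u0; rewrite VN_quad.
have N0 i : 0 < N%:R / (n i)%:R :> R.
  rewrite divr_gt0 ?ltr0n// /N (bigD1 i)//= ltn_addr//.
have [i ui] : exists i, submxcol u i != 0.
  apply/existsP; apply: contraNT u0; rewrite negb_exists => /forallP ui0.
  rewrite -(submxcolK u); apply/eqP.
  have -> : \mxcol_i submxcol u i = \mxcol_i (0 : 'M[R]_(gdim M i, 1)).
    by apply: eq_mxcol => i; apply/eqP; have := ui0 i; rewrite negbK.
  exact: mxcol0.
have q0 j : 0 <= (N%:R / (n j)%:R) *
    ((submxcol u j)^T *m Sigma M j *m submxcol u j) 0 0.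
  apply: mulr_ge0; first exact: ltW.
  have [->|uj] := eqVneq (submxcol u j) 0; first by rewrite mulmx0 mxE.
  exact: ltW ((Sigma_posdef M j).2 _ uj).
rewrite (bigD1 i)//=; apply: ltr_wpDr; first exact: sumr_ge0.
by apply: mulr_gt0 => //; exact: (Sigma_posdef M i).2 _ ui.
Qed.

(** The observations used by a summand whose indices in group [i] are [s i]. *)
Definition group_support (s : forall i, seq 'I_(n i)) : {set {i : 'I_a & 'I_(n i)}} :=
  [set p | tagged p \in s (tag p)].

(** In a difference of two observations of one group the means cancel and the
    covariances add up, whence the factor 2; the groups are independent blocks. *)
Lemma kurt_vec_Z (l1 l2 : index_vector n) : (forall i, l1 i != l2 i) ->
  kurt_vec (group_support (fun i => [:: l1 i; l2 i])) (2 *: VN M) (@Z R a n M l1 l2).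
Proof.
move=> l12; split; first by rewrite linearZ/= VN_sym.
move=> u.
pose c i : R := Num.sqrt (N%:R / (n i)%:R).
have c2 i : c i ^+ 2 = N%:R / (n i)%:R.
  by rewrite sqr_sqrtr// divr_ge0.
pose U i := submxcol u i.
pose F i w := c i * ((U i)^T *m (obs M i (l1 i) w - obs M i (l2 i) w)) 0 0.
pose q i := ((U i)^T *m Sigma M i *m U i) 0 0.
have -> : (fun w => (u^T *m Z l1 l2 w) 0 0) = (fun w => \sum_i F i w).
  apply/funext => w; rewrite -[in LHS](submxcolK u) tr_mxcol /Z mul_mxrow_mxcol.
  rewrite summxE; apply: eq_bigr => i _.
  by rewrite -scalemxAr mxE.
have -> : (u^T *m (2 *: VN M) *m u) 0 0 = \sum_i c i ^+ 2 * (q i + (- 1) ^+ 2 * q i).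
  rewrite -scalemxAr -scalemxAl mxE VN_quad mulr_sumr; apply: eq_bigr => i _.
  by rewrite c2 /q; ring.
have H := @kurt_var_sum _ _ _ _ _ _ _ obs_family_random obs_family_indep
  _ (fun p => tag p) (index_enum 'I_a) (group_support (fun i => [:: l1 i; l2 i])).
have {}H := H (fun i => c i ^+ 2 * (q i + (- 1) ^+ 2 * q i)) F
  (index_enum_uniq _) _.
apply: kurt_var_sub (H _) => [|i].
  by apply/fintype.subsetP => p; rewrite !finset.inE => /andP[].
pose p1 : {i : 'I_a & 'I_(n i)} := Tagged (fun i => 'I_(n i)) (l1 i).
pose p2 : {i : 'I_a & 'I_(n i)} := Tagged (fun i => 'I_(n i)) (l2 i).
have g1 := @kurt_var_normal _ _ _ _ _ _ _ obs_family_random obs_family_indep p1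
  (mean M i) (Sigma M i) (U i) (@obs_normal _ _ _ M i (l1 i)) (Sigma_posdef M i).
have g2 := @kurt_var_normal _ _ _ _ _ _ _ obs_family_random obs_family_indep p2
  (mean M i) (Sigma M i) (U i) (@obs_normal _ _ _ M i (l2 i)) (Sigma_posdef M i).
have p12 p : p \in [set p1]%SET -> p \notin [set p2]%SET.
  rewrite !finset.inE => /eqP ->; rewrite /p1 /p2.
  by rewrite eq_Tagged/= l12.
have := kurt_varZ obs_family_random obs_family_indep (c i)
  (kurt_varD obs_family_random obs_family_indep p12 g1
    (kurt_varZ obs_family_random obs_family_indep (-1) g2)).
rewrite (_ : (fun w => _) = F i); last first.
  apply/funext => w; rewrite /F; congr (_ * _).
  rewrite /obs_family/= !mulmxBr !mxE.
  by ring.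
apply: kurt_var_sub; apply/fintype.subsetP => p; rewrite !finset.inE => /orP[] /eqP ->.
  by rewrite /= !eqxx.
by rewrite /= !eqxx orbT.
Qed.


Let TVT := proj M *m VN M *m proj M.

Lemma kurt_vec_proj_Z (l1 l2 : index_vector n) : (forall i, l1 i != l2 i) ->
  kurt_vec (group_support (fun i => [:: l1 i; l2 i])) (2 *: TVT)
    (fun w => proj M *m @Z R a n M l1 l2 w).
Proof.
move=> l12; have := kurt_vec_mul (proj M) (kurt_vec_Z l12).
by rewrite proj_sym -scalemxAr -scalemxAl.
Qed.

(** The projection is a symmetric idempotent, so that it can be shared between
    the two arguments. *)
Lemma proj_dot (u v : 'cV[R]_D) :
  (u^T *m proj M *m v) 0 0 = \sum_k (proj M *m u) k 0 * (proj M *m v) k 0.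
Proof.
rewrite -dotE trmx_mul proj_sym -!mulmxA (mulmxA (proj M)).
by rewrite proj_idem !mulmxA.
Qed.

Lemma TVT_sym : TVT^T = TVT.
Proof. by rewrite /TVT !trmx_mul VN_sym proj_sym mulmxA. Qed.

Lemma trTVT2E : trTVT2 M = \sum_i \sum_j TVT i j * TVT i j.
Proof.
rewrite /trTVT2 /mxtrace; apply: eq_bigr => i _.
rewrite mxE; apply: eq_bigr => j _; congr (_ * _).
by rewrite -[in RHS]TVT_sym [RHS]mxE.
Qed.

Lemma TVT_diagE k : TVT k k =
  ((col k (proj M))^T *m VN M *m col k (proj M)) 0 0.
Proof.
by rewrite -[LHS]quad_delta /TVT !colE trmx_mul proj_sym !mulmxA.
Qed.

(** A diagonal entry is the quadratic form of the covariance at a column of the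
    projection, and some column is nonzero. *)
Lemma TVT_diag_gt0 : (forall i, (0 < n i)%N) ->
  (forall k, 0 <= TVT k k) /\ exists k, 0 < TVT k k.
Proof.
move=> n0.
have pos k : col k (proj M) != 0 -> 0 < TVT k k.
  by move=> ck; rewrite TVT_diagE; exact: VN_quad_gt0.
split=> [k|].
  have [ck|/pos/ltW//] := eqVneq (col k (proj M)) 0.
  by rewrite TVT_diagE ck mulmx0 mxE.
have [k ck] : exists k, col k (proj M) != 0.
  apply/existsP; apply: contraNT (proj_neq0 M); rewrite negb_exists => /forallP c0.
  apply/eqP/matrixP => i j; have := c0 j; rewrite negbK => /eqP/matrixP/(_ i 0).
  by rewrite !mxE.
by exists k; exact: pos.
Qed.

Lemma trTVT_gt0 : (forall i, (0 < n i)%N) -> 0 < trTVT M.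
Proof.
move=> /TVT_diag_gt0[q0 [k qk]]; rewrite /trTVT /mxtrace (bigD1 k)//=.
by apply: ltr_wpDr => //; apply: sumr_ge0.
Qed.

Lemma trTVT2_gt0 : (forall i, (0 < n i)%N) -> 0 < trTVT2 M.
Proof.
move=> /TVT_diag_gt0[_ [k qk]]; rewrite trTVT2E (bigD1 k)//=.
apply: ltr_wpDr; first by do 2 apply: sumr_ge0 => ? _; rewrite -expr2 sqr_ge0.
rewrite (bigD1 k)//=; apply: ltr_wpDr; last by rewrite mulr_gt0.
by apply: sumr_ge0 => ? _; rewrite -expr2 sqr_ge0.
Qed.

(** Up to the factor 1/2 the summand is the squared norm of the projected
    difference, of covariance 2 T V T. *)
Lemma A1_summand (l1 l2 : index_vector n) : (forall i, l1 i != l2 i) ->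
  let Q w := ((@Z R a n M l1 l2 w)^T *m proj M *m Z l1 l2 w) 0 0 / 2 in
  [/\ tame_span (prob M) obs_family (group_support (fun i => [:: l1 i; l2 i])) Q,
      expect (prob M) Q = trTVT M &
      expect (prob M) (fun w => Q w ^+ 2) <= 64 * (trTVT M) ^+ 2].
Proof.
move=> l12 Q; have rX := obs_family_random; have iX := obs_family_indep.
pose y w := proj M *m @Z R a n M l1 l2 w.
have gy : kurt_vec _ (2 *: TVT) y := kurt_vec_proj_Z l12.
have QE : Q = fun w => 2^-1 * \sum_k y w k 0 ^+ 2.
  by apply/funext => w; rewrite /Q proj_dot mulrC.
have ss := tame_span_sum (index_enum _) (fun k (_ : true) => tame_spanX rX 2 (kurt_vec_tame_span gy k)).
rewrite QE; split; first exact: tame_spanZ.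
- rewrite (expectZ rX iX _ ss) (kurt_vec_trace rX iX gy) linearZ/=.
  by rewrite mulKf.
- have -> : (fun w => (2^-1 * \sum_k y w k 0 ^+ 2) ^+ 2) =
      (fun w => 2^-1 ^+ 2 * (\sum_k y w k 0 ^+ 2) ^+ 2).
    by apply/funext => w; rewrite exprMn.
  rewrite (expectZ rX iX _ (tame_spanX rX 2 ss)).
  have := kurt_vec_trace_sqr rX iX gy; rewrite linearZ/= => h.
  have t2 : 0 <= 2^-1 ^+ 2 :> R by exact: sqr_ge0.
  apply: le_trans (ler_wpM2l t2 h) _.
  rewrite -/(trTVT M); rewrite le_eqVlt; apply/orP; left; apply/eqP.
  by field.
Qed.

(** Up to the factor 1/4 the summand is the squared scalar product of two
    independent projected differences, both of covariance 2 T V T. *)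
Lemma A2_summand (l1 l2 l3 l4 : index_vector n) :
  (forall i, uniq [:: l1 i; l2 i; l3 i; l4 i]) ->
  let Q w := (((@Z R a n M l1 l2 w)^T *m proj M *m Z l3 l4 w) 0 0) ^+ 2 / 4 in
  [/\ tame_span (prob M) obs_family
        (group_support (fun i => [:: l1 i; l2 i; l3 i; l4 i])) Q,
      expect (prob M) Q = trTVT2 M &
      expect (prob M) (fun w => Q w ^+ 2) <= 64 ^+ 2 * (trTVT2 M) ^+ 2].
Proof.
move=> lu Q; have rX := obs_family_random; have iX := obs_family_indep.
pose x w := proj M *m @Z R a n M l1 l2 w.
pose y w := proj M *m @Z R a n M l3 l4 w.
have l12 i : l1 i != l2 i.
  by have := lu i; rewrite /= !in_cons !negb_or => /and4P[/and4P[]].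
have l34 i : l3 i != l4 i.
  by have := lu i; rewrite /= !in_cons !negb_or => /and4P[_ _ /andP[]].
have gx : kurt_vec _ (2 *: TVT) x := kurt_vec_proj_Z l12.
have gy : kurt_vec _ (2 *: TVT) y := kurt_vec_proj_Z l34.
set A := group_support _ in gx; set B := group_support _ in gy.
set C := group_support _.
have AB p : p \in A -> p \notin B.
  rewrite !finset.inE; have := lu (tag p).
  rewrite /= !in_cons !negb_or !in_nil !andbT.
  move=> /and3P[/and3P[_ h13 h14] /andP[h23 h24] _] /orP[] /eqP ->.
    by rewrite h13 h14.
  by rewrite h23 h24.
have AC : A \subset C.
  apply/fintype.subsetP => p; rewrite !finset.inE /= => /orP[] ->//.
  by rewrite orbT.
have BC : B \subset C.
  apply/fintype.subsetP => p; rewrite !finset.inE /= => /orP[] ->.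
    by rewrite !orbT.
  by rewrite !orbT.
have sd : tame_span (prob M) obs_family C (fun w => \sum_k x w k 0 * y w k 0).
  apply: tame_span_sum => k _; apply: tame_spanM => //.
    exact: tame_span_sub AC (kurt_vec_tame_span gx k).
  exact: tame_span_sub BC (kurt_vec_tame_span gy k).
have QE : Q = fun w => 4^-1 * (\sum_k x w k 0 * y w k 0) ^+ 2.
  by apply/funext => w; rewrite /Q proj_dot mulrC.
have trE : \sum_i \sum_j (2 *: TVT) i j * (2 *: TVT) i j = 4 * trTVT2 M.
  rewrite trTVT2E mulr_sumr; apply: eq_bigr => i _.
  rewrite mulr_sumr; apply: eq_bigr => j _; rewrite !mxE.
  by rewrite mulrACA -natrM.
rewrite QE; split; first by apply: tame_spanZ => //; exact: tame_spanX.
- rewrite (expectZ rX iX _ (tame_spanX rX 2 sd)) (expect_dot_sqr rX iX AB gx gy) trE.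
  by rewrite mulKf.
- have -> : (fun w => (4^-1 * (\sum_k x w k 0 * y w k 0) ^+ 2) ^+ 2) =
      (fun w => 4^-1 ^+ 2 * (\sum_k x w k 0 * y w k 0) ^+ 4).
    by apply/funext => w; rewrite exprMn -exprM.
  rewrite (expectZ rX iX _ (tame_spanX rX 4 sd)).
  have := expect_dot_quartic_le rX iX AB gx gy; rewrite trE => h.
  have t2 : 0 <= 4^-1 ^+ 2 :> R by exact: sqr_ge0.
  apply: le_trans (ler_wpM2l t2 h) _.
  rewrite le_eqVlt; apply/orP; left; apply/eqP.
  by field.
Qed.

End model_differences.

(** * Relative error of the two estimators *)

Section ratio_of_counts.
Context (R : realType).

(** The proportion of the admissible tuples that are disjoint from a given one.
    With [c] equal to 1 for pairs and to 6 for quadruples, the two products are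
    the numbers of tuples themselves. *)
Definition count_ratio (c k a : nat) (n : 'I_a -> nat) : R :=
  (\prod_i (c * 'C(n i - k, k)))%N%:R / (\prod_i (c * 'C(n i, k)))%N%:R.

Lemma count_ratio_le1 c k a (n : 'I_a -> nat) : count_ratio c k n <= 1.
Proof.
rewrite /count_ratio; case: (posnP (\prod_i (c * 'C(n i, k)))) => [->|p0].
  by rewrite invr0 mulr0.
rewrite ler_pdivrMr ?ltr0n// mul1r ler_nat; apply: leq_prod => i _.
by rewrite leq_mul2l leq_bin2l ?orbT// leq_subr.
Qed.

End ratio_of_counts.

Section moments_of_estimators.
Context (R : realType) (a : nat) (n : 'I_a -> nat) (M : model R n).
Local Notation IV := (index_vector n).
Let rX := @obs_family_random R a n M.
Let iX := @obs_family_indep R a n M.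
Local Notation Ex := (expect (prob M)).

(** What the conclusions draw on: an unbiased estimator in the algebra of the
    observations whose mean square error, relative to the estimand, is at most
    a constant times the proportion of overlapping pairs of tuples. *)
Definition mse_controlled (K : R) (c k : nat) (est : Omega M -> R) (theta : R) :=
  [/\ 0 < theta, tame_span (prob M) (@obs_family R a n M) [set: _]%SET est,
      Ex est = theta &
      Ex (fun w => (est w / theta - 1) ^+ 2) <= K * (1 - count_ratio R c k n)].

Lemma card_avoid m (s : seq 'I_m) : uniq s ->
  #|[set x | x \notin s]%SET| = (m - size s)%N.
Proof.
move=> us; rewrite cardsE; apply/eqP.
rewrite -(eqn_add2l (size s)) subnKC.
  by rewrite -(card_uniqP us) -[X in _ == X](card_ord m) -(cardC (mem s)).
by rewrite -(card_uniqP us) -[X in (_ <= X)%N](card_ord m) max_card.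
Qed.

Lemma A1_mse_controlled : (forall i, (2 <= n i)%N) ->
  mse_controlled 64 1 2 (@A1 R a n M) (trTVT M).
Proof.
move=> n2; have n0 i : (0 < n i)%N by exact: leq_trans (n2 i).
pose D (q : IV * IV) := [forall i, (q.1 i < q.2 i)%N].
pose s (q : IV * IV) i := [:: q.1 i; q.2 i].
pose Q (q : IV * IV) w :=
  ((@Z R a n M q.1 q.2 w)^T *m proj M *m Z q.1 q.2 w) 0 0 / 2.
pose dj (q q' : IV * IV) := [forall i, all (fun x => x \notin s q i) (s q' i)].
pose c := (\prod_(i < a) (1 * 'C(n i, 2)))%N.
pose c' := (\prod_(i < a) (1 * 'C(n i - 2, 2)))%N.
have Dneq q : D q -> forall i, q.1 i != q.2 i.
  by move=> /forallP Dq i; rewrite -(inj_eq val_inj)/= (ltn_eqF (Dq i)).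
have djP q q' : dj q q' -> forall p,
    p \in group_support (s q) -> p \notin group_support (s q').
  move=> /forallP dq p; rewrite !finset.in_set => pq.
  by apply/negP => h; have := allP (dq (tag p)) _ h; rewrite pq.
have sQ q : D q -> _ := fun Dq => A1_summand M (Dneq q Dq).
have c0 : (0 < c)%N by apply: prodn_gt0 => i; rewrite mul1n bin_gt0.
have cE : (\sum_(q | D q) 1 = c)%N.
  rewrite /D (@count_pairs 'I_a (fun i => 'I_(n i)) (fun i x y => (x < y)%N)).
  apply: eq_bigr => i _.
  rewrite mul1n -[X in 'C(X, _)](card_ord (n i)) -cardsT -count_ordered_pairs.
  by apply: eq_bigr => x _; apply: eq_bigr => y _; rewrite !finset.inE !andbT.
have c'E q : D q -> (\sum_(q' | D q' && dj q q') 1 = c')%N.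
  move=> Dq; rewrite (eq_bigl (fun q' : IV * IV => [forall i,
      [&& (q'.1 i < q'.2 i)%N, q'.1 i \notin s q i & q'.2 i \notin s q i]])).
    rewrite (@count_pairs 'I_a (fun i => 'I_(n i)) (fun i x y =>
      [&& (x < y)%N, x \notin s q i & y \notin s q i])).
    apply: eq_bigr => i _; rewrite mul1n.
    have <- : #|[set x | x \notin s q i]%SET| = (n i - 2)%N.
      by rewrite card_avoid//= in_cons in_nil orbF (Dneq q Dq).
    rewrite -count_ordered_pairs.
    by apply: eq_bigr => x _; apply: eq_bigr => y _; rewrite !finset.inE.
  move=> q'; rewrite /D /dj; apply/andP/forallP => [[/forallP h1 /forallP h2] i|h].
    by rewrite h1; have := h2 i; rewrite /= andbT.
  by split; apply/forallP => i; have /and3P[h1 h2 h3] := h i; rewrite //= h2 h3.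
have QS q (Dq : D q) : tame_span (prob M) (@obs_family R a n M) (group_support (s q)) (Q q).
  by have [] := sQ q Dq.
have QE q (Dq : D q) : Ex (Q q) = trTVT M by have [] := sQ q Dq.
have Q2 q (Dq : D q) : Ex (fun w => Q q w ^+ 2) <= 64 * trTVT M ^+ 2.
  by have [] := sQ q Dq.
have AE : @A1 R a n M = ustat D Q c.
  apply/funext => w; rewrite /A1 /ustat pair_big_dep/= mulr_suml.
  apply: eq_bigr => q _; rewrite /Q natrM invfM mulrA; congr (_ * _%:R^-1).
  by apply: eq_bigr => i _; rewrite mul1n.
rewrite AE; split.
- exact: trTVT_gt0.
- exact: tame_span_ustat QS.
- exact: (expect_ustat rX iX QS QE c0 cE).
- exact: (expect_ustat_var rX iX djP QS QE Q2 c0 cE c'E (trTVT_gt0 M n0)).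
Qed.

Lemma A2_mse_controlled : (forall i, (4 <= n i)%N) ->
  mse_controlled (64 ^+ 2) 6 4 (@A2 R a n M) (trTVT2 M).
Proof.
move=> n4; have n0 i : (0 < n i)%N by exact: leq_trans (n4 i).
pose J := (IV * (IV * (IV * IV)))%type.
pose s (q : J) i := [:: q.1 i; q.2.1 i; q.2.2.1 i; q.2.2.2 i].
pose D (q : J) := [forall i, [&& uniq (s q i), (q.1 i < q.2.1 i)%N &
   (q.2.2.1 i < q.2.2.2 i)%N]].
pose Q (q : J) w :=
  (((@Z R a n M q.1 q.2.1 w)^T *m proj M *m Z q.2.2.1 q.2.2.2 w) 0 0) ^+ 2 / 4.
pose dj (q q' : J) := [forall i, all (fun x => x \notin s q i) (s q' i)].
pose c := (\prod_(i < a) (6 * 'C(n i, 4)))%N.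
pose c' := (\prod_(i < a) (6 * 'C(n i - 4, 4)))%N.
have Duniq q : D q -> forall i, uniq (s q i).
  by move=> /forallP Dq i; have /and3P[] := Dq i.
have djP q q' : dj q q' -> forall p,
    p \in group_support (s q) -> p \notin group_support (s q').
  move=> /forallP dq p; rewrite !finset.in_set => pq.
  by apply/negP => h; have := allP (dq (tag p)) _ h; rewrite pq.
have sQ q : D q -> _ := fun Dq => A2_summand M (Duniq q Dq).
have c0 : (0 < c)%N by apply: prodn_gt0 => i; rewrite muln_gt0 bin_gt0 n4.
have cE : (\sum_(q | D q) 1 = c)%N.
  rewrite /D (@count_quads 'I_a (fun i => 'I_(n i)) (fun i x y z t => [&& uniq [:: x; y; z; t],
    (x < y)%N & (z < t)%N])); apply: eq_bigr => i _.
  rewrite -[X in 'C(X, _)](card_ord (n i)) -cardsT -count_ordered_quads.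
  do 4 (apply: eq_bigr => ? _); congr nat_of_bool; congr [&& _, _ & _].
  by rewrite /= !finset.inE !andbT.
have c'E q : D q -> (\sum_(q' | D q' && dj q q') 1 = c')%N.
  move=> Dq; rewrite (eq_bigl (fun q' : J => [forall i,
      [&& uniq (s q' i), (q'.1 i < q'.2.1 i)%N, (q'.2.2.1 i < q'.2.2.2 i)%N &
       all (fun v => v \in [set x | x \notin s q i]%SET) (s q' i)]])).
    rewrite (@count_quads 'I_a (fun i => 'I_(n i)) (fun i x y z t => [&& uniq [:: x; y; z; t],
      (x < y)%N, (z < t)%N & all (fun v => v \in [set x | x \notin s q i]%SET)
      [:: x; y; z; t]])); apply: eq_bigr => i _.
    by rewrite count_ordered_quads card_avoid// Duniq.
  move=> q'; rewrite /D /dj; apply/andP/forallP => [[/forallP h1 /forallP h2] i|h].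
    have /and3P[-> -> ->] /= := h1 i.
    by have := h2 i; rewrite /= !finset.inE.
  split; apply/forallP => i; have /and4P[h1 h2 h3] := h i.
    by rewrite h1 h2 h3.
  by rewrite /= !finset.inE.
have QS q (Dq : D q) : tame_span (prob M) (@obs_family R a n M) (group_support (s q)) (Q q).
  by have [] := sQ q Dq.
have QE q (Dq : D q) : Ex (Q q) = trTVT2 M by have [] := sQ q Dq.
have Q2 q (Dq : D q) : Ex (fun w => Q q w ^+ 2) <= 64 ^+ 2 * trTVT2 M ^+ 2.
  by have [] := sQ q Dq.
have AE : @A2 R a n M = ustat D Q c.
  apply/funext => w; rewrite /A2 /ustat mulr_suml.
  under eq_bigr => l1 _ do under eq_bigr => l2 _ do rewrite pair_big_dep/=.
  under eq_bigr => l1 _ do rewrite pair_big_dep/=.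
  rewrite pair_big_dep/=.
  by apply: eq_bigr => q _; rewrite /Q natrM invfM mulrA.
rewrite AE; split.
- exact: trTVT2_gt0.
- exact: tame_span_ustat QS.
- exact: (expect_ustat rX iX QS QE c0 cE).
- exact: (expect_ustat_var rX iX djP QS QE Q2 c0 cE c'E (trTVT2_gt0 M n0)).
Qed.

End moments_of_estimators.

(** * Conclusion along a sequence of models *)

Lemma bigminn_le (I : eqType) (r : seq I) (x : nat) (F : I -> nat) j :
  j \in r -> (\big[minn/x]_(i <- r) F i <= F j)%N.
Proof.
elim: r => [//|i r IH]; rewrite in_cons big_cons => /orP[/eqP ->|/IH h].
  exact: geq_minl.
by apply: leq_trans h; exact: geq_minr.
Qed.

(** In each framework the minimum that tends to infinity ranges over all sample
    sizes. *)
Lemma framework_samples_large (F : framework) (a : nat -> nat)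
    (n d : forall nu, 'I_(a nu) -> nat) m :
  in_framework F n d -> \forall nu \near \oo, forall i, (m <= n nu i)%N.
Proof.
have large (x : nat -> nat) :
    (fun nu => \big[minn/x nu]_(i < a nu) n nu i) @ \oo --> \oo ->
    \forall nu \near \oo, forall i, (m <= n nu i)%N.
  move=> /cvgnyPge/(_ m); apply: filterS => nu h i.
  by apply: leq_trans h _; apply: bigminn_le; rewrite mem_index_enum.
by case: F => /= [[_]|[_]|]; exact: large.
Qed.

Section mse_controlled_estimator.
Context (R : realType) (a : nat) (n : 'I_a -> nat) (M : model R n).
Variables (est : estimator R) (theta : estimand R) (K : R) (c k : nat).
Let rX := @obs_family_random R a n M.
Let iX := @obs_family_indep R a n M.
Local Notation Ex := (expect (prob M)).
Hypothesis wb : mse_controlled K c k (est (M := M)) (theta M).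

Let ratio := @ratio_to R est theta a n M.

Let sratio : tame_span (prob M) (@obs_family R a n M) [set: _]%SET ratio.
Proof.
have [_ s _ _] := wb.
have -> : ratio = fun w => (theta M)^-1 * est w.
  by apply/funext => w; rewrite /ratio /ratio_to mulrC.
exact: tame_spanZ.
Qed.

Lemma mse_controlled_unbiased : unbiased est theta M.
Proof.
have [_ s e _] := wb.
by rewrite /unbiased unlock (tame_span_EFin rX iX s) e.
Qed.

Lemma expectation_ratio : ('E_(prob M)[ratio] = 1)%E.
Proof.
have [t0 s e _] := wb.
rewrite unlock (tame_span_EFin rX iX sratio).
have -> : ratio = fun w => (theta M)^-1 * est w.
  by apply/funext => w; rewrite /ratio /ratio_to mulrC.
by rewrite (expectZ rX iX _ s) e mulVf// gt_eqF.
Qed.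

Lemma variance_ratio_le :
  ('V_(prob M)[ratio] <= (K * (1 - count_ratio R c k n))%:E)%E.
Proof.
have [_ _ _ v] := wb.
rewrite /variance unlock expectation_ratio/= unlock.
have s2 := tame_spanX rX 2 (tame_span_add sratio
  (tame_span_cst (prob M) (@obs_family R a n M) [set: _]%SET (- 1))).
rewrite (_ : (fun w => _) = fun w => ((ratio w + - 1) ^+ 2)%:E).
  by rewrite (tame_span_EFin rX iX s2) lee_fin.
by apply/funext => w.
Qed.

Lemma ratio_tail_le (eps : R) : 0 < eps ->
  (prob M [set w | (eps < `|ratio w - 1|)%R] <=
   (eps ^- 2 * (K * (1 - count_ratio R c k n)))%:E)%E.
Proof.
move=> e0; have mr := tame_span_measurable rX iX sratio.
pose Y : {RV (prob M) >-> R} := mfun_Sub (mem_set mr).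
have := @chebyshev _ _ _ _ Y _ e0.
have -> : (Y : Omega M -> R) = ratio by [].
rewrite expectation_ratio /= => h.
have mg : measurable_fun setT (fun w => `|ratio w - 1|).
  by apply: measurableT_comp => //; exact: measurable_funB.
have meps : measurable_fun [set: Omega M] (fun=> eps) by exact: measurable_cst.
apply: (@le_trans _ _ (prob M [set w | (eps <= `|ratio w - 1|)%R])).
  apply: le_measure; rewrite ?classical_sets.inE.
  - by have := measurable_fun_ltr meps mg measurableT (I : measurable [set true]); rewrite setTI.
  - by have := measurable_fun_ler meps mg measurableT (I : measurable [set true]); rewrite setTI.
  - by move=> w /=; exact: ltW.
apply: le_trans h _.
rewrite EFinM; apply: lee_wpmul2l; last exact: variance_ratio_le.
by rewrite lee_fin invr_ge0 exprn_ge0// ltW.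
Qed.

End mse_controlled_estimator.

Section sequence_of_models.
Context (R : realType) (est : estimator R) (theta : estimand R) (K : R) (c k : nat).
Hypothesis K0 : 0 <= K.
Hypothesis c0 : (0 < c)%N.
Hypothesis wb : forall a (n : 'I_a -> nat) (M : model R n),
  (forall i, (k <= n i)%N) -> mse_controlled K c k (est (M := M)) (theta M).

Let bound a0 (n0 : 'I_a0 -> nat) : R := K * (1 - count_ratio R c k n0).

(** Along the sequence the sample sizes eventually reach [2 * k], where the
    quotient of factorials is the proportion of disjoint pairs. *)
Lemma cvg_bound (a : nat -> nat) (n : forall nu, 'I_(a nu) -> nat) :
  (forall m, \forall nu \near \oo, forall i, (m <= n nu i)%N) ->
  (fun nu => fact_ratio R k (n nu)) @ \oo --> (1 : R) ->
  (fun nu => bound (n nu)) @ \oo --> (0 : R).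
Proof.
move=> large cvg1.
have -> : (0 : R) = K * (1 - 1) by rewrite subrr mulr0.
apply: cvgMl_tmp; apply: cvgB; first exact: cvg_cst.
apply: cvg_trans cvg1; apply: near_eq_cvg.
near=> nu; rewrite -(prod_bin_ratio R c0)//.
by near: nu; exact: large.
Unshelve. all: by end_near. Qed.

Lemma mse_controlled_dimensionally_stable (a : nat -> nat)
    (n : forall nu, 'I_(a nu) -> nat) :
  (forall m, \forall nu \near \oo, forall i, (m <= n nu i)%N) ->
  (fun nu => fact_ratio R k (n nu)) @ \oo --> (1 : R) ->
  dimensionally_stable k est theta n.
Proof.
move=> large cvg1; exists bound; split; first exact: cvg_bound.
move=> nu kn M; have w := wb M kn; split; last exact: variance_ratio_le.
rewrite (expectation_ratio w) subee// abse0 lee_fin mulr_ge0//.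
by rewrite subr_ge0 count_ratio_le1.
Qed.

Lemma mse_controlled_ratio_consistent (a : nat -> nat)
    (n : forall nu, 'I_(a nu) -> nat) (M : forall nu, model R (n nu)) :
  (forall m, \forall nu \near \oo, forall i, (m <= n nu i)%N) ->
  (fun nu => fact_ratio R k (n nu)) @ \oo --> (1 : R) ->
  ratio_consistent est theta M.
Proof.
move=> large cvg1 eps e0.
apply: (@squeeze_cvge _ _ _ _ (cst 0%E) _
  (fun nu => (eps ^- 2 * bound (n nu))%:E)).
- near=> nu; rewrite measure_ge0/=; apply: ratio_tail_le => //; apply: wb.
  by near: nu; exact: large.
- exact: cvg_cst.
- apply/fine_cvgP; split; first exact: nearW.
  rewrite -[X in _ --> X](mulr0 (eps ^- 2)).
  by apply: cvgMl_tmp; exact: cvg_bound.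
Unshelve. all: by end_near. Qed.

End sequence_of_models.

Theorem lemma3p1 (R : realType) (F : framework) (a : nat -> nat)
    (n : forall nu, 'I_(a nu) -> nat) (M : forall nu, model R (n nu)) :
  in_framework F n (fun nu => gdim (M nu)) ->
  ((forall nu, (forall i, (2 <= n nu i)%N) ->
      unbiased (@A1 R) (@trTVT R) (M nu)) /\
   ((fun nu => fact_ratio R 2 (n nu)) @ \oo --> (1 : R) ->
      dimensionally_stable 2 (@A1 R) (@trTVT R) n /\
      ratio_consistent (@A1 R) (@trTVT R) M)) /\
  ((forall nu, (forall i, (4 <= n nu i)%N) ->
      unbiased (@A2 R) (@trTVT2 R) (M nu)) /\
   ((fun nu => fact_ratio R 4 (n nu)) @ \oo --> (1 : R) ->
      dimensionally_stable 4 (@A2 R) (@trTVT2 R) n /\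
      ratio_consistent (@A2 R) (@trTVT2 R) M)).
Proof.
move=> inF; have large m := framework_samples_large m inF.
split; split.
- by move=> nu n2; exact: mse_controlled_unbiased (A1_mse_controlled (M nu) n2).
- move=> cvg1; split.
    exact: (mse_controlled_dimensionally_stable (ler0n _ 64) (isT : (0 < 1)%N)
      (@A1_mse_controlled R) large cvg1).
  exact: (@mse_controlled_ratio_consistent R (@A1 R) (@trTVT R) 64 1 2 isT
    (@A1_mse_controlled R) a n M large cvg1).
- by move=> nu n4; exact: mse_controlled_unbiased (A2_mse_controlled (M nu) n4).
- move=> cvg1; split.
    exact: (mse_controlled_dimensionally_stable (sqr_ge0 _) (isT : (0 < 6)%N)
      (@A2_mse_controlled R) large cvg1).
  exact: (@mse_controlled_ratio_consistent R (@A2 R) (@trTVT2 R) (64 ^+ 2) 6 4 isT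
    (@A2_mse_controlled R) a n M large cvg1).
Qed.
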